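(* Let $\Gamma$ be a finite simplicial graph and $A=A(\Gamma)$ the right-angled Artin group it determines. The group $P\Sigma(A)$ is isomorphic to a right-angled Artin group if and only if $\Gamma$ contains no separating intersection of links (SIL).
   Context: $A(\Gamma)$ is the group generated by the vertex set $V$ of $\Gamma$ subject to $ab=ba$ for all adjacent $a,b$. $P\Sigma(A)$ is the pure symmetric automorphism group: the group of all automorphisms of $A$ that map each vertex (standard generator) to a conjugate of itself. For $a\in V$, $\mathrm{Lk}(a)$ is the set of vertices adjacent to $a$. For $W\subseteq V$, $\Gamma\setminus W$ is the full subgraph spanned by $V\setminus W$. $\Gamma$ has a separating intersection of links (SIL) if there is a pair $a,b$ of distinct non-adjacent vertices such that $\Gamma\setminus(\mathrm{Lk}(a)\cap\mathrm{Lk}(b))$ has a connected component containing neither $a$ nor $b$. *)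

(* Defs.v *)
From HB Require Import structures.
From mathcomp Require Import all_boot.
From mathcomp Require Import boolp.

Set Implicit Arguments.
Unset Strict Implicit.
Unset Printing Implicit Defensive.

Local Open Scope group_scope.
Local Open Scope quotient_scope.

Record sgraph := SGraph {
  vertex :> finType;
  adj : rel vertex;
  adj_sym : symmetric adj;
  adj_irr : irreflexive adj }.

Arguments adj {s} x y.

Section Graphs.
Variable G : sgraph.

Definition link (a : G) : {set G} := [set x | adj a x].

Section FullSubgraph.
Variable U : {set G}.

Definition full_adj : rel {x : G | x \in U} := fun x y => adj (val x) (val y).

Lemma full_adj_sym : symmetric full_adj.
Proof. by move=> x y; apply: adj_sym. Qed.

Lemma full_adj_irr : irreflexive full_adj.
Proof. by move=> x; apply: adj_irr. Qed.

Definition full_subgraph : sgraph := SGraph full_adj_sym full_adj_irr.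

End FullSubgraph.

Definition graph_minus (W : {set G}) : sgraph := full_subgraph (~: W).

Definition components : {set {set G}} :=
  equivalence_partition (connect (@adj G)) [set: G].

End Graphs.

Definition has_SIL (G : sgraph) : Prop :=
  exists a b : G, [/\ a != b, ~~ adj a b &
    exists2 C : {set graph_minus (link a :&: link b)},
      C \in components (graph_minus (link a :&: link b)) &
      forall c, c \in C -> val c != a /\ val c != b].

Section RightAngledArtinGroup.
Variable G : sgraph.

(* The letter (v, true) stands for v and (v, false) for its inverse. *)
Definition word := seq (G * bool).

(* The congruence on words presenting < V | uv = vu for u, v adjacent >. *)
Inductive raag_cong : word -> word -> Prop :=
| raag_refl w : raag_cong w w
| raag_sym w1 w2 : raag_cong w1 w2 -> raag_cong w2 w1
| raag_trans w1 w2 w3 :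
    raag_cong w1 w2 -> raag_cong w2 w3 -> raag_cong w1 w3
| raag_cat w1 w2 w3 w4 :
    raag_cong w1 w2 -> raag_cong w3 w4 -> raag_cong (w1 ++ w3) (w2 ++ w4)
| raag_cancel v b : raag_cong [:: (v, b); (v, ~~ b)] [::]
| raag_comm u v : adj u v ->
    raag_cong [:: (u, true); (v, true)] [:: (v, true); (u, true)].

Definition raag_eq : rel word := fun w1 w2 => `[< raag_cong w1 w2 >].

Lemma raag_eq_refl : reflexive raag_eq.
Proof. by move=> w; apply/asboolP; constructor. Qed.

Lemma raag_eq_sym : symmetric raag_eq.
Proof. by move=> w1 w2; apply/asboolP/asboolP; apply: raag_sym. Qed.

Lemma raag_eq_trans : transitive raag_eq.
Proof.
by move=> w2 w1 w3 /asboolP h1 /asboolP h2; apply/asboolP; apply: raag_trans h2.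
Qed.

Canonical raag_equiv := EquivRel raag_eq raag_eq_refl raag_eq_sym raag_eq_trans.

Definition raag := {eq_quot raag_equiv}.

HB.instance Definition _ := Choice.on raag.
HB.instance Definition _ := Quotient.on raag.

Definition inv_word (w : word) : word := rev [seq (l.1, ~~ l.2) | l <- w].

Definition raag_one : raag := \pi_raag [::].
Definition raag_mul (x y : raag) : raag := \pi_raag (repr x ++ repr y).
Definition raag_inv (x : raag) : raag := \pi_raag (inv_word (repr x)).

Lemma raag_piP w1 w2 : \pi_raag w1 = \pi_raag w2 <-> raag_cong w1 w2.
Proof.
split; first by move/eqmodP/asboolP.
by move=> h; apply/eqmodP/asboolP.
Qed.

Lemma raag_reprK w : raag_cong (repr (\pi_raag w)) w.
Proof. by apply/raag_piP; rewrite reprK. Qed.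

Lemma inv_word_cong w1 w2 :
  raag_cong w1 w2 -> raag_cong (inv_word w1) (inv_word w2).
Proof.
elim=> {w1 w2} [w|w1 w2 _ h|w1 w2 w3 _ h1 _ h2|w1 w2 w3 w4 _ h1 _ h2|v b|u v uv].
- exact: raag_refl.
- exact: raag_sym.
- exact: raag_trans h2.
- by rewrite /inv_word !map_cat !rev_cat; apply: raag_cat.
- by rewrite /inv_word /rev /= negbK; apply: raag_cancel.
rewrite /inv_word /rev /=.
pose p := [:: (v, false); (u, false)]; pose q := [:: (u, false); (v, false)].
rewrite -/p -/q.
have pK : raag_cong (p ++ [:: (u, true); (v, true)]) [::].
  apply: (@raag_trans _ [:: (v, false); (v, true)]); last exact: raag_cancel.
  apply: (@raag_cat [:: (v, false)] [:: (v, false)]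
            [:: (u, false); (u, true); (v, true)] [:: (v, true)]).
    exact: raag_refl.
  apply: (@raag_cat [:: (u, false); (u, true)] [::] [:: (v, true)] [:: (v, true)]).
    exact: raag_cancel.
  exact: raag_refl.
have qK : raag_cong ([:: (v, true); (u, true)] ++ q) [::].
  apply: (@raag_trans _ [:: (v, true); (v, false)]); last exact: raag_cancel.
  apply: (@raag_cat [:: (v, true)] [:: (v, true)]
            [:: (u, true); (u, false); (v, false)] [:: (v, false)]).
    exact: raag_refl.
  apply: (@raag_cat [:: (u, true); (u, false)] [::] [:: (v, false)] [:: (v, false)]).
    exact: raag_cancel.
  exact: raag_refl.
apply: (@raag_trans _ (p ++ [:: (u, true); (v, true)] ++ q)).
  rewrite -[in X in raag_cong X _](cats0 p).
  apply: raag_cat; first exact: raag_refl.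
  apply: raag_sym; apply: raag_trans qK.
  by apply: raag_cat; [apply: raag_comm | apply: raag_refl].
by rewrite catA -[in X in raag_cong _ X](cat0s q);
   apply: raag_cat => //; apply: raag_refl.
Qed.

Lemma inv_wordK w : raag_cong (w ++ inv_word w) [::].
Proof.
elim: w => [|[v b] w IHw]; first exact: raag_refl.
rewrite /inv_word /= rev_cons -cats1 -/(inv_word w) catA.
apply: (@raag_trans _ [:: (v, b); (v, ~~ b)]); last exact: raag_cancel.
apply: (@raag_cat [:: (v, b)] [:: (v, b)] _ [:: (v, ~~ b)]).
  exact: raag_refl.
by apply: (@raag_cat _ [::] _ [:: (v, ~~ b)]) => //; apply: raag_refl.
Qed.

Lemma inv_wordKV w : raag_cong (inv_word w ++ w) [::].
Proof.
suff {2}-> : w = inv_word (inv_word w) by apply: inv_wordK.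
rewrite /inv_word map_rev revK -map_comp map_id_in // => -[v b] _ /=.
by rewrite negbK.
Qed.

Lemma raag_mulA : associative raag_mul.
Proof.
move=> x y z; apply/raag_piP.
apply: (@raag_trans _ (repr x ++ repr y ++ repr z)).
  by apply: raag_cat; [apply: raag_refl | apply: raag_reprK].
rewrite catA; apply: raag_cat; last exact: raag_refl.
by apply: raag_sym; apply: raag_reprK.
Qed.

Lemma raag_mul1 : left_id raag_one raag_mul.
Proof.
move=> x; rewrite -[RHS]reprK; apply/raag_piP.
by apply: (@raag_cat _ [::]); [apply: raag_reprK | apply: raag_refl].
Qed.

Lemma raag_mulr1 : right_id raag_one raag_mul.
Proof.
move=> x; rewrite -[RHS]reprK; apply/raag_piP; rewrite -[in X in raag_cong _ X](cats0 (repr x)).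
by apply: raag_cat; [apply: raag_refl | apply: raag_reprK].
Qed.

Lemma raag_mulV : left_inverse raag_one raag_inv raag_mul.
Proof.
move=> x; apply/raag_piP; apply: raag_trans (inv_wordKV (repr x)).
by apply: raag_cat; [apply: raag_reprK | apply: raag_refl].
Qed.

Lemma raag_mulrV : right_inverse raag_one raag_inv raag_mul.
Proof.
move=> x; apply/raag_piP; apply: raag_trans (inv_wordK (repr x)).
by apply: raag_cat; [apply: raag_refl | apply: raag_reprK].
Qed.

HB.instance Definition _ :=
  isGroup.Build raag raag_mulA raag_mul1 raag_mulr1 raag_mulV raag_mulrV.

Definition raag_gen (v : G) : raag := \pi_raag [:: (v, true)].

End RightAngledArtinGroup.

Section Automorphisms.
Variable H : groupType.

(* The inverse map is carried as data; it is determined by [aut_fun]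
   (see [autP] below). *)
Record aut := Aut {
  aut_fun :> H -> H;
  aut_inv : H -> H;
  aut_funM : {morph aut_fun : x y / x * y};
  aut_funK : cancel aut_fun aut_inv;
  aut_invK : cancel aut_inv aut_fun }.

Lemma autP (f g : aut) : f =1 g -> f = g.
Proof.
case: f g => [f f' fM fK f'K] [g g' gM gK g'K] /= /funext fg.
subst g; have e : f' = g' by apply/funext => x; rewrite -[x in LHS]g'K fK.
by subst g'; congr Aut; apply: Prop_irrelevance.
Qed.

HB.instance Definition _ := gen_eqMixin aut.
HB.instance Definition _ := gen_choiceMixin aut.

Lemma aut_invM (f : aut) : {morph aut_inv f : x y / x * y}.
Proof.
move=> x y; apply: (can_inj (@aut_funK f)).
by rewrite aut_funM !aut_invK.
Qed.

Definition aut_one : aut :=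
  @Aut id id (fun x y => erefl) (fun x => erefl) (fun x => erefl).

Lemma aut_compM (f g : aut) : {morph f \o g : x y / x * y}.
Proof. by move=> x y /=; rewrite !aut_funM. Qed.

Definition aut_mul (f g : aut) : aut :=
  Aut (aut_compM f g) (can_comp (@aut_funK f) (@aut_funK g))
      (can_comp (@aut_invK g) (@aut_invK f)).

Definition aut_opp (f : aut) : aut :=
  Aut (aut_invM f) (@aut_invK f) (@aut_funK f).

Lemma aut_mulA : associative aut_mul.
Proof. by move=> f g h; apply: autP. Qed.

Lemma aut_mul1 : left_id aut_one aut_mul.
Proof. by move=> f; apply: autP. Qed.

Lemma aut_mulr1 : right_id aut_one aut_mul.
Proof. by move=> f; apply: autP. Qed.

Lemma aut_mulV : left_inverse aut_one aut_opp aut_mul.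
Proof. by move=> f; apply: autP => x /=; rewrite aut_funK. Qed.

Lemma aut_mulrV : right_inverse aut_one aut_opp aut_mul.
Proof. by move=> f; apply: autP => x /=; rewrite aut_invK. Qed.

HB.instance Definition _ :=
  isGroup.Build aut aut_mulA aut_mul1 aut_mulr1 aut_mulV aut_mulrV.

End Automorphisms.

Section PureSymmetric.
Variable G : sgraph.

Definition pure_symmetric : {pred aut (raag G)} :=
  fun phi => `[< forall v : G, exists g : raag G,
                   phi (raag_gen v) = raag_gen v ^ g >].

Lemma pure_symmetric_closed : group_closed pure_symmetric.
Proof.
have autJ (phi : aut (raag G)) x y : phi (x ^ y) = phi x ^ phi y.
  have h : phi y * phi (x ^ y) = phi y * (phi x ^ phi y).
    by rewrite -aut_funM -!conjgC aut_funM.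
  exact: mulgI h.
split; first by apply/asboolP => v; exists 1; rewrite conjg1.
move=> phi psi /asboolP hphi /asboolP hpsi; apply/asboolP => v.
have [g hg] := hpsi v; have [k hk] := hphi v.
pose h := aut_inv psi g^-1.
have {}hg : aut_inv psi (raag_gen v) = raag_gen v ^ h.
  apply: (can_inj (@aut_funK _ psi)).
  by rewrite autJ !aut_invK hg conjgK.
exists (k * phi h).
have -> : (phi / psi) (raag_gen v) = phi (aut_inv psi (raag_gen v)) by [].
by rewrite hg autJ hk conjgM.
Qed.

(* The group structure on [PSigma] is that of a subgroup of
   [aut (raag G)]. *)
Record PSigma := PSig {
  psig_val : aut (raag G);
  _ : psig_val \in pure_symmetric }.

HB.instance Definition _ := [isSub for psig_val].
HB.instance Definition _ := [Choice of PSigma by <:].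
HB.instance Definition _ :=
  SubChoice_isSubGroup.Build _ _ PSigma pure_symmetric_closed.

End PureSymmetric.

Definition isomorphic (H K : groupType) : Prop :=
  exists f : {multiplicative H -> K}, bijective f.

Definition is_raag (H : groupType) : Prop :=
  exists D : sgraph, isomorphic H (raag D).

(* Main.v *)
From Stdlib Require Import ZArith Lia.
From HB Require Import structures.
From mathcomp Require Import all_boot.
From mathcomp Require Import boolp.
Require Import Defs.

Set Implicit Arguments.
Unset Strict Implicit.
Unset Printing Implicit Defensive.

Local Open Scope group_scope.

(* A letter [l] "begins" an element of a graph group when some reduced word of
   the element starts with [l].  The sets of elements that begin with [l] are the
   half-spaces of the Cayley graph, and an exchange condition holds: if right
   multiplication by a letter [s] moves [k] into the half-space of [l], then
   [k s = l k].

   Generation (Laurence).  Let [phi v = z_v v z_v^-1] and transport the half-space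
   of each letter [v^+-1] by [z_v].  If none of these contains 1 or a point [z_w]
   with [w] outside the star of [v], a ping-pong argument shows that [phi]
   preserves the relation "begins", and a surjective such [phi] is the identity.
   Otherwise a partial conjugation shortens the conjugators.

   Without SIL, two partial conjugations (a, K), (b, L) commute unless [b \in K]
   and [a \in L], so the graph group D on the components maps onto PSigma.  A kernel
   element has zero exponents, hence lies in the subgroup generated by the products
   of all (a, K) for fixed [a], which contains all commutators; there the map is
   [g |-> inner automorphism of g], whose kernel is central and trivial in D.

   With SIL (a, b, c), let K and C be the components of the complement of the star
   of [a] containing [b] and [c].  The characters [e_K], [e_C - e_K] and [e_C] of
   PSigma dual to (a, K), (a, C) are resonant, because of homomorphisms and an
   antihomomorphism to a free group of rank 2.  But the values at (a, K), (a, C) of a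
   resonant character are multiples of (1, 0), (0, 1) or (1, -1).  In a graph group
   every linear subspace of resonant characters lies in a resonant coordinate
   subspace, and coordinate subspaces form a distributive lattice; three lines in one
   plane contradict this. *)

(** * Words and normal forms *)

Section Morphisms.
Variables (H K : groupType) (f : H -> K).
Hypothesis fM : {morph f : x y / x * y}.

Lemma morph1 : f 1 = 1.
Proof. by apply: (mulgI (f 1)); rewrite -fM !mulg1. Qed.

Lemma morphV : {morph f : x / x^-1}.
Proof. by move=> x; apply: (mulgI (f x)); rewrite -fM !mulgV morph1. Qed.

Lemma morph_commute x y : commute x y -> commute (f x) (f y).
Proof. by rewrite /commute -!fM => ->. Qed.

End Morphisms.

Section Words.
Variable G : sgraph.
Implicit Types (u v : G) (l m s : G * bool) (x y : raag G) (w : word G).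

Definition linv l : G * bool := (l.1, ~~ l.2).

Lemma linvK : involutive linv.
Proof. by case=> v b; rewrite /linv /= negbK. Qed.

Definition letter l : raag G := \pi_(raag G)%qT [:: l].

Lemma pi_cat w1 w2 :
  \pi_(raag G)%qT (w1 ++ w2) = \pi_(raag G)%qT w1 * \pi_(raag G)%qT w2.
Proof.
by apply/raag_piP; apply: raag_cat; apply: raag_sym; apply: raag_reprK.
Qed.

Lemma pi_nil : \pi_(raag G)%qT [::] = 1. Proof. by []. Qed.

Lemma pi_cons l w : \pi_(raag G)%qT (l :: w) = letter l * \pi_(raag G)%qT w.
Proof. by rewrite -cat1s pi_cat. Qed.

Lemma letter_true v : letter (v, true) = raag_gen v. Proof. by []. Qed.

Lemma letterK l : letter l * letter (linv l) = 1.
Proof.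
rewrite -pi_cat; apply/raag_piP; case: l => v b; exact: raag_cancel.
Qed.

Lemma letterVK l : letter (linv l) * letter l = 1.
Proof. by rewrite -{2}[l]linvK letterK. Qed.

Lemma letter_linv l : letter (linv l) = (letter l)^-1.
Proof. by rewrite -(mulg1_eq (letterK l)). Qed.

Lemma letter_false v : letter (v, false) = (raag_gen v)^-1.
Proof. exact: (letter_linv (v, true)). Qed.

Lemma letterE l : letter l = if l.2 then raag_gen l.1 else (raag_gen l.1)^-1.
Proof. by case: l => v [] /=; rewrite ?letter_true ?letter_false. Qed.

Lemma gen_commute u v : adj u v -> commute (raag_gen u) (raag_gen v).
Proof.
move=> uv; rewrite /commute -!letter_true -!pi_cat; apply/raag_piP.
exact: raag_comm.
Qed.

Lemma commute_letterP l x : commute (letter l) x <-> commute (raag_gen l.1) x.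
Proof.
rewrite letterE; case: l.2 => //=; split=> /commute_sym/commuteV/commute_sym //.
by rewrite invgK.
Qed.

Lemma letter_commute l m : adj l.1 m.1 -> commute (letter l) (letter m).
Proof.
move=> lm; apply/commute_letterP/commute_sym/commute_letterP; apply: gen_commute.
by rewrite adj_sym.
Qed.

Lemma raag_ind (P : raag G -> Prop) :
  P 1 -> (forall l x, P x -> P (letter l * x)) -> forall x, P x.
Proof.
move=> P1 PM x; rewrite -[x]reprK; elim: (repr x) => [//|l w IHw].
by rewrite pi_cons; apply: PM.
Qed.

Lemma raag_ext (K : groupType) (f g : raag G -> K) :
  {morph f : x y / x * y} -> {morph g : x y / x * y} ->
  (forall v, f (raag_gen v) = g (raag_gen v)) -> f =1 g.
Proof.
move=> fM gM fg; elim/raag_ind => [|l x IHx]; first by rewrite !morph1.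
by rewrite fM gM IHx letterE; case: l.2; rewrite ?(morphV fM) ?(morphV gM) fg.
Qed.

Section Lift.
Variables (K : groupType) (f : G -> K).

Definition letterev l := if l.2 then f l.1 else (f l.1)^-1.
Definition wordev w : K := foldr (fun l k => letterev l * k) 1 w.
Definition raag_lift x : K := wordev (repr x).

Hypothesis f_comm : forall u v, adj u v -> commute (f u) (f v).

Lemma wordev_cat w1 w2 : wordev (w1 ++ w2) = wordev w1 * wordev w2.
Proof. by elim: w1 => [|l w1 IH] /=; rewrite ?mul1g // IH mulgA. Qed.

Lemma wordev_cong w1 w2 : raag_cong w1 w2 -> wordev w1 = wordev w2.
Proof.
elim=> {w1 w2} // [w1 w2 w3 _ -> _ -> //|w1 w2 w3 w4 _ h1 _ h2|v b|u v uv].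
- by rewrite !wordev_cat h1 h2.
- by rewrite /= mulg1 /letterev /=; case: b; rewrite /= ?mulgV ?mulVg.
- by rewrite /= !mulg1 /letterev /=; apply: f_comm.
Qed.

Lemma lift_pi w : raag_lift (\pi_(raag G)%qT w) = wordev w.
Proof. by apply: wordev_cong; apply: raag_reprK. Qed.

Lemma liftM : {morph raag_lift : x y / x * y}.
Proof.
by move=> x y; rewrite -[x]reprK -[y]reprK -pi_cat !lift_pi wordev_cat.
Qed.

Lemma lift_letter l : raag_lift (letter l) = letterev l.
Proof. by rewrite lift_pi /= mulg1. Qed.

Lemma lift_gen v : raag_lift (raag_gen v) = f v.
Proof. exact: (lift_letter (v, true)). Qed.

End Lift.

Section NormalForms.

(* A state records, for each ordered pair of vertices, the projection of a
   reduced word to the letters on these two vertices; only pairs of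
   non-adjacent (possibly equal) vertices are used.  By trace theory these
   projections determine the reduced word up to shuffling. *)
Definition state := G * G -> word G.

Definition touch (v : G) (p : G * G) :=
  ~~ adj p.1 p.2 && ((p.1 == v) || (p.2 == v)).

Definition push l (P : state) : state :=
  fun p => if touch l.1 p then l :: P p else P p.
Definition pop l (P : state) : state :=
  fun p => if touch l.1 p then behead (P p) else P p.
Definition starts l (P : state) :=
  [forall p, touch l.1 p ==> (ohead (P p) == Some l)].
Definition act l P := if starts (linv l) P then pop l P else push l P.
Definition empty : state := fun=> [::].

Lemma touch_diag v : touch v (v, v).
Proof. by rewrite /touch /= adj_irr eqxx. Qed.

Lemma touch_pair u v : ~~ adj u v -> touch u (u, v) /\ touch v (u, v).
Proof. by move=> uv; rewrite /touch /= uv !eqxx orbT. Qed.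

Lemma touch_adj u v p : adj u v -> touch u p -> ~~ touch v p.
Proof.
case: p => a b uv /andP[/= np up]; apply/negP => /andP[_ /= vp].
case/orP: up => /eqP ea; case/orP: vp => /eqP eb; move: uv np;
  by rewrite -ea -eb ?adj_irr // ?[adj b a]adj_sym => ->.
Qed.

Lemma starts_empty l : ~~ starts l empty.
Proof. by apply/forallPn; exists (l.1, l.1); rewrite touch_diag. Qed.

Lemma starts_push l P : starts l (push l P).
Proof. by apply/forallP => p; apply/implyP; rewrite /push => ->. Qed.

Lemma pop_push l P : pop l (push l P) = P.
Proof. by apply/funext => p; rewrite /pop /push; case: (touch l.1 p). Qed.

Lemma pop_linv l : pop (linv l) = pop l. Proof. by []. Qed.

Lemma push_pop l P : starts l P -> push l (pop l P) = P.
Proof.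
move=> /forallP lP; apply/funext => p; rewrite /pop /push.
by case: ifP => // tp; move: (lP p); rewrite tp /=; case: (P p) => // ? ? /eqP[->].
Qed.

Lemma starts_excl l m P :
  starts l P -> starts m P -> ~~ adj l.1 m.1 -> l = m.
Proof.
move=> /forallP lP /forallP mP /touch_pair[t1 t2].
move: (lP (l.1, m.1)) (mP (l.1, m.1)); rewrite t1 t2 /= => /eqP-> /eqP[//].
Qed.

Lemma starts_push_adj l m P : adj l.1 m.1 -> starts l (push m P) = starts l P.
Proof.
move=> lm; apply: eq_forallb => p; rewrite /push; case tp: (touch l.1 p) => //=.
by rewrite (negbTE (touch_adj lm tp)).
Qed.

Lemma starts_pop_adj l m P : adj l.1 m.1 -> starts l (pop m P) = starts l P.
Proof.
move=> lm; apply: eq_forallb => p; rewrite /pop; case tp: (touch l.1 p) => //=.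
by rewrite (negbTE (touch_adj lm tp)).
Qed.

Lemma starts_act_adj l m P : adj l.1 m.1 -> starts l (act m P) = starts l P.
Proof.
by move=> lm; rewrite /act; case: ifP => _;
   rewrite ?starts_pop_adj ?starts_push_adj.
Qed.

Lemma pop_push_adj l m P : adj l.1 m.1 -> pop m (push l P) = push l (pop m P).
Proof.
move=> lm; apply/funext => p; rewrite /pop /push; case tp: (touch l.1 p) => //.
by rewrite (negbTE (touch_adj lm tp)).
Qed.

Lemma act_adj l m P : adj l.1 m.1 -> act l (act m P) = act m (act l P).
Proof.
move=> lm; have ml : adj m.1 l.1 by rewrite adj_sym.
rewrite {1 3}/act !starts_act_adj // /act.
do 2 case: ifP => _; rewrite ?pop_push_adj //; apply/funext => p.
  rewrite /pop; case tl: (touch l.1 p) => //.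
  by rewrite (negbTE (touch_adj lm tl)).
rewrite /push; case tl: (touch l.1 p) => //.
by rewrite (negbTE (touch_adj lm tl)).
Qed.

(** [P] comes from a reduced word for [x]. The laws [act_linv] and [starts_act] need such states:
    once a letter is popped, an unreduced state may start with its inverse. *)
Inductive represents : raag G -> state -> Prop :=
| represents_one : represents 1 empty
| represents_push l x P :
    represents x P -> ~~ starts (linv l) P -> represents (letter l * x) (push l P).

Lemma starts_adj l m P : starts m (push l P) -> l != m ->
  adj m.1 l.1.
Proof.
move=> mP; apply: contraR => ml.
by rewrite (starts_excl mP (starts_push l P) ml).
Qed.

(** The letter [m] is either the last one pushed or, by [starts_adj], commutes with it and is found
    deeper in the reduced word. *)
Lemma represents_pop x P m : represents x P -> starts m P ->
  represents (letter (linv m) * x) (pop m P) /\ ~~ starts (linv m) (pop m P).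
Proof.
elim=> {x P} [|l x P xP IH nl] mP; first by case/negP: (starts_empty m).
have [<-|lm] := eqVneq l m.
  by rewrite pop_push mulgA letterVK mul1g.
have ml := starts_adj mP lm; rewrite starts_push_adj // in mP.
have lm' : adj l.1 m.1 by rewrite adj_sym.
have [xQ nQ] := IH mP.
rewrite pop_push_adj // starts_push_adj //; split=> //.
have -> : letter (linv m) * (letter l * x) = letter l * (letter (linv m) * x).
  by rewrite !mulgA (@letter_commute (linv m)).
by apply: represents_push => //; rewrite starts_pop_adj.
Qed.

Lemma represents_act x P l : represents x P -> represents (letter l * x) (act l P).
Proof.
move=> xP; rewrite /act; case: ifP => [sP|/negbT nP].
  by case: (represents_pop xP sP); rewrite linvK.
exact: represents_push.
Qed.

Lemma act_linv x P l : represents x P -> act (linv l) (act l P) = P.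
Proof.
move=> xP; rewrite {2}/act; case: ifP => [sP|/negbT nP].
  have [_] := represents_pop xP sP; rewrite -pop_linv /act => /negbTE ->.
  exact: push_pop.
by rewrite /act linvK starts_push pop_linv pop_push.
Qed.

Lemma starts_act x P l : represents x P ->
  starts l (act l P) = ~~ starts (linv l) P.
Proof.
move=> xP; rewrite {1}/act; case: ifP => [sP|/negbT nP]; last exact: starts_push.
by have [_] := represents_pop xP sP; rewrite linvK => /negbTE.
Qed.

Lemma represents_acts w x P : represents x P ->
  represents (\pi_(raag G)%qT w * x) (foldr act P w).
Proof.
move=> xP; elim: w => [|l w IH] /=; first by rewrite pi_nil mul1g.
by rewrite pi_cons -mulgA; apply: represents_act.
Qed.

Lemma acts_cong w1 w2 : raag_cong w1 w2 ->
  forall x P, represents x P -> foldr act P w1 = foldr act P w2.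
Proof.
elim=> {w1 w2} // [w1 w2 _ h x P xP|w1 w2 w3 _ h1 _ h2 x P xP|
                   w1 w2 w3 w4 _ h1 _ h2 x P xP|v b x P xP|u v uv x P xP].
- by rewrite (h x).
- by rewrite (h1 x) ?(h2 x).
- rewrite !foldr_cat (h2 x) //; apply: h1; exact: represents_acts xP.
- by have /= := act_linv (linv (v, b)) xP; rewrite linvK.
- exact: act_adj.
Qed.

Definition nf x : state := foldr act empty (repr x).

Lemma nf_pi w : nf (\pi_(raag G)%qT w) = foldr act empty w.
Proof. apply: (acts_cong _ represents_one); exact: raag_reprK. Qed.

Lemma nf1 : nf 1 = empty. Proof. exact: nf_pi [::]. Qed.

Lemma nf_letter l x : nf (letter l * x) = act l (nf x).
Proof. by rewrite -[x]reprK -pi_cons !nf_pi. Qed.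

Lemma represents_nf x : represents x (nf x).
Proof.
elim/raag_ind: x => [|l x IH]; first by rewrite nf1; exact: represents_one.
by rewrite nf_letter; apply: represents_act.
Qed.

Definition begins l x := starts l (nf x).

(** The projection to [(v, v)] lists the letters on [v], so this is the length of a reduced word. *)
Definition len x : nat := \sum_(v : G) size (nf x (v, v)).

Lemma begins1 l : begins l 1 = false.
Proof. by rewrite /begins nf1; apply/negbTE/starts_empty. Qed.

Lemma begins_letter l x : begins l (letter l * x) = ~~ begins (linv l) x.
Proof. by rewrite /begins nf_letter (starts_act _ (represents_nf x)). Qed.

Lemma begins_adj l m x : adj l.1 m.1 -> begins l (letter m * x) = begins l x.
Proof. by move=> lm; rewrite /begins nf_letter starts_act_adj. Qed.

Lemma begins_excl l m x :
  begins l x -> begins m x -> ~~ adj l.1 m.1 -> l = m.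
Proof. exact: starts_excl. Qed.

Lemma begins_linv l x : begins l x -> begins (linv l) x = false.
Proof.
move=> lx; apply/negP => /(begins_excl lx); rewrite /= adj_irr => /(_ isT).
by case: l {lx} => v [].
Qed.

Lemma nf_represents x P : represents x P -> nf x = P.
Proof.
elim=> [|l {}x {}P _ IH nP]; first exact: nf1.
by rewrite nf_letter IH /act (negbTE nP).
Qed.

Lemma raag_split x :
  x = 1 \/ exists l y, x = letter l * y /\ begins (linv l) y = false.
Proof.
case: (represents_nf x) => [|l y P yP nP]; first by left.
by right; exists l, y; split=> //; rewrite /begins (nf_represents yP) (negbTE nP).
Qed.

Lemma begins_neq1 x : x <> 1 -> exists l, begins l x.
Proof.
case: (raag_split x) => // -[l [y [-> ny]]] _.
by exists l; rewrite begins_letter ny.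
Qed.

Lemma len_begins l x : begins l x -> len x = (len (letter (linv l) * x)).+1.
Proof.
rewrite /begins /len nf_letter => lx; rewrite /act linvK lx pop_linv.
have td v : touch l.1 (v, v) = (v == l.1) by rewrite /touch /= adj_irr orbb.
rewrite (bigD1 l.1) // [in RHS](bigD1 l.1) //= -addSn; congr addn.
  rewrite /pop td eqxx; move/forallP: lx => /(_ (l.1, l.1)).
  by rewrite td eqxx /=; case: (nf x _).
by apply: eq_bigr => v /negbTE nv; rewrite /pop td nv.
Qed.

Lemma len_letter l x : begins (linv l) x = false -> len (letter l * x) = (len x).+1.
Proof.
move=> lx; have: begins l (letter l * x) by rewrite begins_letter lx.
by move/len_begins; rewrite mulgA letterVK mul1g.
Qed.

Lemma len1 : len 1 = 0%N.
Proof. by rewrite /len nf1 big1. Qed.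

(** The hypothesis covers all [y] no longer than [x], because [exchange_both] applies it to an
    element other than the tail [x]. *)
Lemma len_ind (P : raag G -> Prop) :
  P 1 ->
  (forall l x, begins (linv l) x = false ->
     (forall y, (len y <= len x)%N -> P y) -> P (letter l * x)) ->
  forall x, P x.
Proof.
move=> P1 PM x; move: {-1}(len x) (leqnn (len x)) => n.
elim: n x => [|n IH] x; case: (raag_split x) => [-> //|[l [y [-> ny]]]];
  rewrite len_letter // ltnS => yn.
by apply: PM => // z zy; apply: IH; apply: leq_trans yn.
Qed.

Lemma len_word x : exists2 w, x = \pi_(raag G)%qT w & size w = len x.
Proof.
elim/len_ind: x => [|l x lx IH]; first by exists [::]; rewrite ?len1.
have [w xw sw] := IH x (leqnn _).
by exists (l :: w); rewrite ?pi_cons -?xw //= sw len_letter.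
Qed.

Lemma len_pi w : (len (\pi_(raag G)%qT w) <= size w)%N.
Proof.
elim: w => [|l w IH]; first by rewrite pi_nil len1.
rewrite pi_cons /=; case lw: (begins (linv l) (\pi_(raag G)%qT w)).
  by move: IH; rewrite (len_begins lw) linvK => /ltnW/leqW.
by rewrite len_letter.
Qed.

Lemma pi_inv w : \pi_(raag G)%qT (inv_word w) = (\pi_(raag G)%qT w)^-1.
Proof.
apply: (mulIg (\pi_(raag G)%qT w)); rewrite -pi_cat mulVg.
by apply/raag_piP; apply: inv_wordKV.
Qed.

Lemma lenV x : len x^-1 = len x.
Proof.
suff le y : (len y^-1 <= len y)%N.
  by apply/eqP; rewrite eqn_leq le -{1}[x]invgK le.
have [w -> <-] := len_word y; rewrite -pi_inv; apply: leq_trans (len_pi _) _.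
by rewrite /inv_word size_rev size_map.
Qed.

Lemma raag_indr (P : raag G -> Prop) :
  P 1 -> (forall l x, P x -> P (x * letter l)) -> forall x, P x.
Proof.
move=> P1 PM x; rewrite -[x]invgK; elim/raag_ind: x^-1 => [|l {}x IH].
  by rewrite invg1.
by rewrite invgM -letter_linv; apply: PM.
Qed.

End NormalForms.
End Words.

Arguments len {G} x%_g.

(** * Exponent sums, the Heisenberg group and the exchange condition *)

Inductive heis := Heis { hx : Z; hy : Z; hz : Z }.

HB.instance Definition _ := gen_eqMixin heis.
HB.instance Definition _ := gen_choiceMixin heis.

(** Unitriangular integer matrices of size three, with [hz] the corner entry. *)
Definition heis_mul p q :=
  Heis (hx p + hx q) (hy p + hy q) (hz p + hz q + hx p * hy q).
Definition heis_one := Heis 0 0 0.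
Definition heis_inv p := Heis (- hx p) (- hy p) (- hz p + hx p * hy p).

Fact heis_mulA : associative heis_mul.
Proof. by case=> ? ? ? [? ? ?] [? ? ?]; rewrite /heis_mul /=; congr Heis; lia. Qed.
Fact heis_mul1 : left_id heis_one heis_mul.
Proof. by case=> ? ? ?; rewrite /heis_mul /=; congr Heis; lia. Qed.
Fact heis_mulr1 : right_id heis_one heis_mul.
Proof. by case=> ? ? ?; rewrite /heis_mul /=; congr Heis; lia. Qed.
Fact heis_mulV : left_inverse heis_one heis_inv heis_mul.
Proof.
by case=> ? ? ?; rewrite /heis_mul /heis_one /=; congr Heis; lia.
Qed.
Fact heis_mulrV : right_inverse heis_one heis_inv heis_mul.
Proof.
by case=> ? ? ?; rewrite /heis_mul /heis_one /=; congr Heis; lia.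
Qed.
HB.instance Definition _ :=
  isGroup.Build heis heis_mulA heis_mul1 heis_mulr1 heis_mulV heis_mulrV.

Definition additive (H : groupType) (e : H -> Z) :=
  {morph e : x y / x * y >-> (x + y)%Z}.

Section Additive.
Variables (H : groupType) (e : H -> Z).
Hypothesis eM : additive e.

Lemma additive1 : e 1 = 0%Z.
Proof. by have := eM 1 1; rewrite mulg1; lia. Qed.

Lemma additiveV x : e x^-1 = (- e x)%Z.
Proof. by have := eM x x^-1; rewrite mulgV additive1; lia. Qed.

End Additive.

Section Exponents.
Variable G : sgraph.
Implicit Types (u v : G) (l m s : G * bool) (x y : raag G) (f : G -> Z).

Definition expo f x : Z := hx (raag_lift (fun v => Heis (f v) 0 0) x).

Lemma expo_comm f u v : adj u v -> commute (Heis (f u) 0 0) (Heis (f v) 0 0).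
Proof. by move=> _; rewrite /commute /mul /= /heis_mul /=; congr Heis; lia. Qed.

Lemma expoM f : additive (expo f).
Proof. by move=> x y; rewrite /expo (liftM (@expo_comm f)). Qed.

Lemma expo_gen f v : expo f (raag_gen v) = f v.
Proof. by rewrite /expo (lift_gen (@expo_comm f)). Qed.

Lemma additive_letter (e : raag G -> Z) l : additive e ->
  e (letter l) = if l.2 then e (raag_gen l.1) else (- e (raag_gen l.1))%Z.
Proof. by move=> eM; rewrite letterE; case: l.2 => //; rewrite (additiveV eM). Qed.

Lemma additive_ext (e e' : raag G -> Z) : additive e -> additive e' ->
  (forall v, e (raag_gen v) = e' (raag_gen v)) -> e =1 e'.
Proof.
move=> eM e'M ee; elim/raag_ind => [|l x IH].
  by rewrite (additive1 eM) (additive1 e'M).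
by rewrite eM e'M IH (additive_letter _ eM) (additive_letter _ e'M) ee.
Qed.

(* Commuting elements of a graph group have commuting images in the Heisenberg
   group; comparing the central coordinates gives the identity. *)
Lemma expo_minor f g x y :
  (forall u v, adj u v -> (f u * g v = f v * g u)%Z) -> commute x y ->
  (expo f x * expo g y = expo f y * expo g x)%Z.
Proof.
move=> fg xy; pose h v := Heis (f v) (g v) 0.
have hC u v : adj u v -> commute (h u) (h v).
  move=> /fg e; rewrite /commute /mul /= /heis_mul /=; congr Heis; lia.
have hM := liftM hC.
have ex p : hx (raag_lift h p) = expo f p.
  apply: (@additive_ext (fun p => hx (raag_lift h p)) (expo f)) => [q r|q r|v].
  - by rewrite hM.
  - exact: expoM.
  - by rewrite (lift_gen hC) expo_gen.
have ey p : hy (raag_lift h p) = expo g p.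
  apply: (@additive_ext (fun p => hy (raag_lift h p)) (expo g)) => [q r|q r|v].
  - by rewrite hM.
  - exact: expoM.
  - by rewrite (lift_gen hC) expo_gen.
have := congr1 hz (morph_commute hM xy).
rewrite /mul /= !ex !ey; lia.
Qed.

Definition ex v : raag G -> Z := expo (fun u => if u == v then 1%Z else 0%Z).

Lemma exM v : additive (ex v). Proof. exact: expoM. Qed.

Lemma ex_gen u v : ex v (raag_gen u) = if u == v then 1%Z else 0%Z.
Proof. exact: expo_gen. Qed.

Lemma ex_letter v l :
  ex v (letter l) = if l.1 == v then (if l.2 then 1%Z else (-1)%Z) else 0%Z.
Proof.
by rewrite (additive_letter l (exM v)) ex_gen; case: l.2; case: (l.1 == v).
Qed.

(** Exponent sums are invariant under conjugation and tell letters apart. *)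
Lemma letter_conj_inj l m x : letter l * x = x * letter m -> l = m.
Proof.
move=> lm; have e v : ex v (letter l) = ex v (letter m).
  by move: (congr1 (ex v) lm); rewrite !exM; lia.
move: (e l.1) (e m.1); rewrite !ex_letter !eqxx.
case: l m {lm e} => [u b] [v c] /=; rewrite [v == u]eq_sym.
by case: eqP => [->|_]; case: b; case: c.
Qed.

Lemma letter_inj : injective (@letter G).
Proof. by move=> l m lm; apply: (@letter_conj_inj l m 1); rewrite mulg1 mul1g. Qed.

Lemma begins_letter1 l s : begins l (letter s) -> l = s.
Proof.
move=> lb; have sb : begins s (letter s) by rewrite -[letter s]mulg1 begins_letter begins1.
apply: (begins_excl lb sb); apply: contraL lb => ls.
by rewrite -[letter s]mulg1 begins_adj // begins1.
Qed.

(** One induction on the length of [k] serves both directions: entering a half-space uses both of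
    them for the tail of [k], and leaving that of [l] is entering that of [linv l] for the shorter
    element l^-1 k. *)
Lemma exchange_both k : forall s l,
  (begins l (k * letter s) -> ~~ begins l k -> k * letter s = letter l * k) /\
  (begins l k -> ~~ begins l (k * letter s) -> k * letter s = letter (linv l) * k).
Proof.
elim/len_ind: k => [|t x tx IH] s l.
  by rewrite mul1g mulg1 begins1; split=> // /begins_letter1 ->.
have IHx := IH x (leqnn _); split=> [lb nl|lb nl].
  case la: (adj l.1 t.1).
    move: lb nl; rewrite -mulgA !begins_adj // => lb nl.
    by rewrite (IHx s l).1 // !mulgA (letter_commute la).
  have tk : begins t (letter t * x) by rewrite begins_letter tx.
  have lnt : l != t by apply: contraNneq nl => ->.
  (* As [l] and [t] do not commute, [s] must have cancelled the first letter [t], so that t x s = x.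
     The second direction for [x] then forces l = t. *)
  have tb : begins (linv t) (x * letter s).
    apply: contraNT lnt => nt; apply/eqP; apply: (begins_excl lb); last by rewrite la.
    by rewrite -mulgA begins_letter.
  have xs := (IHx s (linv t)).1 tb (negbT tx).
  have kx : letter t * x * letter s = x by rewrite -mulgA xs mulgA letterK mul1g.
  have lx : begins l x by rewrite -kx.
  have ll : l != linv t by apply: contraTneq lx => ->; rewrite tx.
  have nlx : ~~ begins l (x * letter s).
    by apply: contraNN ll => lxs; apply/eqP; apply: (begins_excl lxs tb); rewrite la.
  have := (IHx s l).2 lx nlx; rewrite xs => /mulIg/letter_inj e.
  by case/eqP: lnt; rewrite -[l]linvK -e linvK.
have [y ey] : exists y, y = letter (linv l) * (letter t * x) by eexists.
have ky : letter t * x = letter l * y by rewrite ey mulgA letterK mul1g.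
have yx : (len y <= len x)%N by rewrite ey -ltnS -(len_begins lb) len_letter.
move: lb nl; rewrite ky -mulgA !begins_letter negbK => ny ly.
have ys := (IH y yx s (linv l)).1 ly ny.
by rewrite ys !mulgA letterK letterVK mul1g.
Qed.

Lemma exchange k s l : begins l (k * letter s) -> ~~ begins l k ->
  k * letter s = letter l * k /\ s = l.
Proof.
move=> lb nl; have e := (exchange_both k s l).1 lb nl; split=> //.
by rewrite -(letter_conj_inj (esym e)).
Qed.

Lemma exchangeV k s l : begins l k -> ~~ begins l (k * letter s) ->
  k * letter s = letter (linv l) * k /\ s = linv l.
Proof.
move=> lb nl; have e := (exchange_both k s l).2 lb nl; split=> //.
by rewrite -(letter_conj_inj (esym e)).
Qed.

End Exponents.

(** * Centralizers of generators and double cosets of star subgroups *)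

Section Centralizers.
Variable G : sgraph.
Implicit Types (u v : G) (l m s : G * bool) (x y : raag G) (S : {set G}).

Definition star v : {set G} := v |: link v.

Lemma in_link u v : (u \in link v) = adj v u. Proof. by rewrite inE. Qed.

Lemma in_star u v : (u \in star v) = (u == v) || adj v u.
Proof. by rewrite !inE. Qed.

Inductive gen_sub S : raag G -> Prop :=
| gen_sub1 : gen_sub S 1
| gen_sub_cons l x : l.1 \in S -> gen_sub S x -> gen_sub S (letter l * x).

Lemma gen_subM S x y : gen_sub S x -> gen_sub S y -> gen_sub S (x * y).
Proof.
elim=> [|l {}x lS _ IH] Sy; first by rewrite mul1g.
by rewrite -mulgA; apply: gen_sub_cons; auto.
Qed.

Lemma gen_sub_letter S l : l.1 \in S -> gen_sub S (letter l).
Proof. by move=> lS; rewrite -[letter l]mulg1; apply: gen_sub_cons => //; left. Qed.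

Lemma gen_subV S x : gen_sub S x -> gen_sub S x^-1.
Proof.
elim=> [|l {}x lS _ IH]; first by rewrite invg1; left.
by rewrite invgM -letter_linv; apply: gen_subM => //; apply: gen_sub_letter.
Qed.

Lemma gen_sub_commute S v x :
  gen_sub S x -> {subset S <= star v} -> commute x (raag_gen v).
Proof.
move=> Sx SS; elim: Sx => [|l {}x /SS lS _ IH]; apply: commute_sym.
  exact: commute1.
apply: commuteM; last exact: commute_sym.
apply/commute_sym/commute_letterP; move: lS; rewrite in_star => /orP[/eqP->|vl].
  exact: commute_refl.
by apply: gen_commute; rewrite adj_sym.
Qed.

(** If [l.1] were outside the star, x v = v x would begin with [v] and hence not with [l]; the step
    from x to x v would leave the half-space of [l], which only a letter on [l.1] can do. *)
Lemma commute_begins x v l :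
  commute x (raag_gen v) -> begins l x -> l.1 \in star v.
Proof.
move=> xv lx; apply/negPn/negP; rewrite in_star negb_or adj_sym => /andP[lv nlv].
have nvx : begins (v, false) x = false.
  apply/negP => /(begins_excl lx)/(_ nlv) e; by move: lv; rewrite e eqxx.
have vvx : begins (v, true) (letter (v, true) * x) by rewrite begins_letter nvx.
have nl : ~~ begins l (x * letter (v, true)).
  rewrite letter_true xv; apply/negP => /begins_excl/(_ vvx)/(_ nlv) e.
  by move: lv; rewrite e eqxx.
have [_ e] := exchangeV lx nl; move: lv.
by case: l e {lx nl nlv} => u b /= [-> _]; rewrite eqxx.
Qed.

Lemma centralizer_gen x v : commute x (raag_gen v) -> gen_sub (star v) x.
Proof.
elim/len_ind: x => [|l x lx IH] xv; first by left.
have lS : l.1 \in star v by apply: (commute_begins xv); rewrite begins_letter lx.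
apply: gen_sub_cons => //; apply: IH => //.
have lv : commute (raag_gen v) (letter l).
  apply/commute_sym/(@gen_sub_commute (star v)) => //; exact: gen_sub_letter.
have -> : x = (letter l)^-1 * (letter l * x) by rewrite mulKg.
apply: commute_sym; apply: commuteM; last exact: commute_sym.
exact: commuteV.
Qed.

Lemma gen_sub_ex S v x : gen_sub S x -> v \notin S -> ex v x = 0%Z.
Proof.
move=> Sx vS; elim: Sx => [|l {}x lS _ IH]; first exact: additive1 (exM v).
rewrite (exM v) IH ex_letter; case: eqP => // e; by move: vS; rewrite -e lS.
Qed.

(** Letters on [v] move to the front past the link. Their exponent is kept as a difference of two
    natural numbers, so that no negative powers occur. *)
Lemma star_split v x : gen_sub (star v) x -> exists (m n : nat) y,
  gen_sub (link v) y /\ raag_gen v ^+ m * x = raag_gen v ^+ n * y.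
Proof.
elim=> [|l {}x lS _ [m [n [y [yL e]]]]].
  by exists 0%N, 0%N, 1; split; [left | rewrite mulg1].
move: lS; rewrite in_star => /orP[/eqP lv|vl].
  case lb: l.2.
    exists m, n.+1, y; split=> //.
    by rewrite letterE lb lv mulgA -expgSr expgS -[LHS]mulgA e mulgA -expgS.
  exists m.+1, n, y; split=> //.
  by rewrite letterE lb lv expgSr -mulgA mulVKg.
exists m, n, (letter l * y); split.
  by apply: gen_sub_cons; rewrite ?in_link.
have lv k : commute (letter l) (raag_gen v ^+ k).
  by apply: commuteX; apply/commute_letterP; apply: gen_commute; rewrite adj_sym.
by rewrite !mulgA -!lv -!mulgA e.
Qed.

Lemma centralizer_link x v :
  commute x (raag_gen v) -> ex v x = 0%Z -> gen_sub (link v) x.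
Proof.
move=> /centralizer_gen/star_split[m [n [y [yL e]]]] ex0.
have exX k : ex v (raag_gen v ^+ k) = Z.of_nat k.
  elim: k => [|k IH]; first exact: additive1 (exM v).
  by rewrite expgS (exM v) IH ex_gen eqxx; lia.
have vL : v \notin link v by rewrite in_link adj_irr.
have mn : m = n.
  by move: (congr1 (ex v) e); rewrite !(exM v) !exX ex0 (gen_sub_ex yL vL); lia.
by move: e; rewrite mn => /mulgI ->.
Qed.

Lemma begins_link l x y : gen_sub (link l.1) x -> begins l (x * y) = begins l y.
Proof.
elim=> [|m {}x mL _ IH]; first by rewrite mul1g.
by rewrite -mulgA begins_adj -?in_link.
Qed.

(** A word for [x] spells a path from [k] to k x, and one of its letters leaves the half-space of
    [l]; [c] is that letter conjugated by the prefix before it. *)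
Lemma exit_step S x : gen_sub S x -> forall k l,
  begins l k -> ~~ begins l (k * x) ->
  exists2 c, gen_sub S c & k * c = letter (linv l) * k.
Proof.
elim=> [|m {}x mS _ IH] k l lk nl; first by rewrite mulg1 lk in nl.
case lkm: (begins l (k * letter m)).
  have [|c Sc e] := IH _ _ lkm; first by rewrite -mulgA.
  exists (letter m * c * (letter m)^-1).
    apply: gen_subM; first exact: gen_sub_cons.
    by rewrite -letter_linv; apply: gen_sub_letter.
  by rewrite !mulgA e !mulgA mulgK.
exists (letter m); first exact: gen_sub_letter.
by have [] := exchangeV lk (negbT lkm).
Qed.

(** Strip the first letter [a] of [i]. If it lies in the star of [v], it joins [q]. Otherwise v i no
    longer begins with [a], and [exit_step] moves [a] to the right end of [i] as an element of the
    star subgroup of [w]. *)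
Lemma double_coset v w i : gen_sub (star w) (i^-1 * raag_gen v * i) ->
  exists q p, [/\ gen_sub (star v) q, gen_sub (star w) p & i = q * p].
Proof.
elim/len_ind: i => [|a i ai IH] Sm.
  by exists 1, 1; split; rewrite ?mulg1 //; left.
have bi : begins a (letter a * i) by rewrite begins_letter ai.
case aS: (a.1 \in star v).
  have [|q [p [qS pS e]]] := IH i (leqnn _).
    have /commute_sym va : commute (letter a) (raag_gen v).
      by apply: (@gen_sub_commute (star v)) => //; apply: gen_sub_letter.
    move: Sm; rewrite invgM -!mulgA (mulgA (raag_gen v)) va.
    by rewrite -mulgA mulKg mulgA.
  by exists (letter a * q), p; split; rewrite -?mulgA ?e //; apply: gen_sub_cons.
have im : letter a * i * ((letter a * i)^-1 * raag_gen v * (letter a * i)) =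
    raag_gen v * (letter a * i).
  by rewrite !mulgA mulgV mul1g.
have nav : ~~ adj a.1 v.
  by apply: contraFN aS; rewrite in_star adj_sym => ->; rewrite orbT.
have av : a.1 != v by apply: contraFneq aS => ->; rewrite in_star eqxx.
have vi : begins (v, true) (raag_gen v * (letter a * i)).
  rewrite begins_letter; apply/negP => /(begins_excl bi)/(_ nav) e.
  by move: av; rewrite e eqxx.
have na : ~~ begins a (letter a * i * ((letter a * i)^-1 * raag_gen v * (letter a * i))).
  rewrite im; apply/negP => /begins_excl/(_ vi)/(_ nav) e.
  by move: av; rewrite e eqxx.
have [c Sc ic] := exit_step Sm bi na.
have ei : letter a * i = i * c^-1 by rewrite -[LHS](mulgK c) ic mulgA letterVK mul1g.
have [|q [p [qS pS e]]] := IH i (leqnn _).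
  have {1 2}-> : i = letter a * i * c by rewrite ei mulgVK.
  move: Sm; set X := letter a * i => Sm.
  have -> : (X * c)^-1 * raag_gen v * (X * c) = c^-1 * (X^-1 * raag_gen v * X) * c.
    by rewrite invgM !mulgA.
  by apply: gen_subM => //; apply: gen_subM => //; apply: gen_subV.
exists q, (p * c^-1); split=> //; first by apply: gen_subM => //; apply: gen_subV.
by rewrite ei e mulgA.
Qed.

End Centralizers.

(** * Partial conjugations *)

Section PartialConjugations.
Variable G : sgraph.
Implicit Types (u v w : G) (l m s : G * bool) (x y p q : raag G) (K : {set G}).

Definition star_rel u : rel G :=
  fun v w => [&& adj v w, v \notin star u & w \notin star u].

Lemma star_rel_sym u : connect_sym (star_rel u).
Proof.
by apply: sym_connect_sym => v w; rewrite /star_rel adj_sym; congr andb; rewrite andbC.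
Qed.

(* The component of [w] in the complement of the star of [u]; empty when [w]
   lies in that star. *)
Definition component u w : {set G} :=
  [set v | [&& w \notin star u, v \notin star u & connect (star_rel u) w v]].

Lemma in_comp u w v : (v \in component u w) =
  [&& w \notin star u, v \notin star u & connect (star_rel u) w v].
Proof. by rewrite inE. Qed.

(** Equivalently, [K] is a union of connected components of the complement of the star of [u]. *)
Definition saturated u K :=
  [forall v in K, (v \notin star u) &&
     [forall w, adj v w ==> (w \in star u) || (w \in K)]].

Lemma saturatedP u K : reflect
  (forall v, v \in K -> v \notin star u /\
     forall w, adj v w -> w \notin star u -> w \in K) (saturated u K).
Proof.
apply: (iffP forall_inP) => h v vK.
  have /andP[vu /forallP hw] := h v vK; split=> // w vw wu.
  by move: (hw w); rewrite vw (negbTE wu).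
have [vu hw] := h v vK; rewrite vu; apply/forallP => w; apply/implyP => vw.
by case wu: (w \in star u) => //=; apply: hw; rewrite ?wu.
Qed.

Lemma saturated0 u : saturated u set0.
Proof. by apply/saturatedP => v; rewrite inE. Qed.

Lemma saturated_comp u w : saturated u (component u w).
Proof.
apply/saturatedP => v; rewrite in_comp => /and3P[wu vu wv]; split=> // v' vv' v'u.
rewrite in_comp wu v'u /=; apply: connect_trans wv _; apply: connect1.
by rewrite /star_rel vv' vu v'u.
Qed.

Definition clean u K := if saturated u K then K else set0.

Lemma saturated_clean u K : saturated u (clean u K).
Proof. by rewrite /clean; case: ifP => // _; apply: saturated0. Qed.

Definition pc_gen l K v : raag G :=
  if v \in K then letter l * raag_gen v * letter (linv l) else raag_gen v.

Lemma pc_gen_comm l K u v : saturated l.1 K -> adj u v ->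
  commute (pc_gen l K u) (pc_gen l K v).
Proof.
move=> /saturatedP okK uv; have auv := gen_commute uv.
have case1 a b : adj a b -> a \in K -> b \notin K ->
    commute (letter l * raag_gen a * letter (linv l)) (raag_gen b).
  move=> ab aK bK; have [aS hb] := okK a aK.
  have bS : b \in star l.1 by apply: contraNT bK; apply: hb.
  have lb : commute (letter l) (raag_gen b).
    apply/commute_letterP; move: bS; rewrite in_star => /orP[/eqP->|]; first by [].
    exact: gen_commute.
  apply: commute_sym; rewrite letter_linv; apply: commuteM.
    by apply: commuteM; [exact: commute_sym | apply/commute_sym/gen_commute].
  by apply: commuteV; apply: commute_sym.
rewrite /pc_gen; case: ifP => uK; case: ifP => vK //.
- by rewrite /commute letter_linv -!mulgA !mulKg !(mulgA (raag_gen _)) auv.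
- by apply: case1; rewrite ?vK.
- by apply/commute_sym/case1; rewrite ?uK // adj_sym.
Qed.

Definition pc_fun l K : raag G -> raag G := raag_lift (pc_gen l (clean l.1 K)).

Lemma pc_funM l K : {morph pc_fun l K : x y / x * y}.
Proof. by apply: liftM => u v; apply: pc_gen_comm; apply: saturated_clean. Qed.

Lemma pc_fun_gen l K v : pc_fun l K (raag_gen v) = pc_gen l (clean l.1 K) v.
Proof.
by apply: lift_gen => {}v w; apply: pc_gen_comm; apply: saturated_clean.
Qed.

Lemma clean_notin l K : l.1 \notin clean l.1 K.
Proof.
by apply/negP => /(saturatedP _ _ (saturated_clean _ _))[]; rewrite in_star eqxx.
Qed.

Lemma pc_fun_letter l K m : m.1 = l.1 -> pc_fun l K (letter m) = letter m.
Proof.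
move=> ml; rewrite letterE ml.
by case: m.2; rewrite ?(morphV (pc_funM l K)) pc_fun_gen /pc_gen
   (negbTE (clean_notin _ _)).
Qed.

Lemma pc_fun_linvK l K : cancel (pc_fun l K) (pc_fun (linv l) K).
Proof.
have cM : {morph pc_fun (linv l) K \o pc_fun l K : x y / x * y}.
  by move=> x y; rewrite /= !pc_funM.
apply: (raag_ext cM) => // v /=; rewrite pc_fun_gen /pc_gen.
case: ifP => vK; last by rewrite pc_fun_gen /pc_gen vK.
rewrite !pc_funM (@pc_fun_letter _ K l) // (@pc_fun_letter _ K (linv l)) //.
rewrite pc_fun_gen /pc_gen vK.
by rewrite linvK letter_linv !mulgA mulgV mul1g mulgK.
Qed.

Lemma pc_funK l K : cancel (pc_fun (linv l) K) (pc_fun l K).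
Proof. by have := @pc_fun_linvK (linv l) K; rewrite linvK. Qed.

(* Partial conjugation of [K] by [l], for [K] a union of components of the
   complement of the star of [l.1]; the identity for any other [K]. *)
Definition pc l K : aut (raag G) :=
  Aut (pc_funM l K) (@pc_fun_linvK l K) (@pc_funK l K).

Lemma pc_genE l K v : saturated l.1 K ->
  pc l K (raag_gen v) =
    if v \in K then letter l * raag_gen v * letter (linv l) else raag_gen v.
Proof. by move=> okK; rewrite /= pc_fun_gen /pc_gen /clean okK. Qed.

Lemma pcV l K : pc (linv l) K = (pc l K)^-1.
Proof. by apply: autP. Qed.

End PartialConjugations.

Lemma aut_ext (G : sgraph) (phi psi : aut (raag G)) :
  (forall v, phi (raag_gen v) = psi (raag_gen v)) -> phi = psi.
Proof. by move=> h; apply: autP; apply: raag_ext h; apply: aut_funM. Qed.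

Lemma autM (H : groupType) (f g : aut H) x : (f * g) x = f (g x).
Proof. by []. Qed.

(** * Ping-pong with transported half-spaces *)

Section PureMorphism.
Variables (G : sgraph) (phi : raag G -> raag G) (z : G -> raag G).
Implicit Types (u v w : G) (l m s : G * bool) (x y p q : raag G) (K : {set G}).
Hypothesis phiM : {morph phi : x y / x * y}.
Hypothesis phi_gen : forall v, phi (raag_gen v) = z v * raag_gen v * (z v)^-1.

Lemma phi_letter l : phi (letter l) = z l.1 * letter l * (z l.1)^-1.
Proof.
rewrite letterE; case: l.2 => //; rewrite (morphV phiM) phi_gen.
by rewrite !invgM invgK mulgA.
Qed.

Lemma phi_ex v x : ex v (phi x) = ex v x.
Proof.
have eM : additive (ex v \o phi) by move=> p q; rewrite /= phiM exM.
apply: (additive_ext eM (exM v)) => u /=.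
by rewrite phi_gen !exM (additiveV (exM v)); lia.
Qed.

(* Images of the half-spaces [begins l] of the Cayley graph under the
   conjugators [z]; [phi (letter l)] translates one along the axis of the image of
   the generator [l.1]. *)
Definition halfspace l p := begins l ((z l.1)^-1 * p).

Lemma half_cross l p s : ~~ halfspace l p -> halfspace l (p * letter s) ->
  p * letter s = phi (letter l) * p /\ s = l.
Proof.
rewrite /halfspace mulgA => nl lb; have [e sl] := exchange lb nl; split=> //.
by apply: (mulgI (z l.1)^-1); rewrite mulgA e phi_letter -!mulgA mulKg.
Qed.

Lemma half_crossV l p s : halfspace l p -> ~~ halfspace l (p * letter s) -> s = linv l.
Proof. by rewrite /halfspace mulgA => lb nl; have [] := exchangeV lb nl. Qed.

(** Every edge across the boundary of the half-space is labelled by [l.1], which does not occur in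
    [c]. *)
Lemma half_coset l w p c :
  gen_sub (star w) c -> l.1 \notin star w -> halfspace l (p * c) = halfspace l p.
Proof.
move=> wc lw; elim: wc p => [|s {}c sS _ IH] p; first by rewrite mulg1.
rewrite mulgA IH; apply/idP/idP; apply: contraTT => h; apply/negP => h'.
  by have [_ e] := half_cross h h'; rewrite -e sS in lw.
by have e := half_crossV h' h; move: sS; rewrite e (negbTE lw).
Qed.

Lemma half_cross_coset l p s : ~~ halfspace l p -> halfspace l (p * letter s) ->
  exists c, [/\ gen_sub (star l.1) c, p = z l.1 * c & s = l].
Proof.
move=> nl lb; have [_ sl] := half_cross nl lb; subst s.
exists ((z l.1)^-1 * p); split; rewrite ?mulVKg //; apply: centralizer_gen.
apply: commute_sym; apply: (commute_letterP l _).1.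
move: lb; rewrite /halfspace mulgA => lb.
by have [e _] := exchange lb nl; rewrite /commute e.
Qed.

(** Walk from 1 to [p]. A step entering the half-space of [l] happens inside the coset of [z l.1] by
    the star subgroup of [l.1], and by [half_coset] this coset lies outside the half-space of [m],
    as [z l.1] does; the same holds with [l] and [m] exchanged. *)
Lemma half_disjoint l m p : l.1 != m.1 -> ~~ adj l.1 m.1 ->
  ~~ halfspace l 1 -> ~~ halfspace m (z l.1) -> ~~ halfspace l (z m.1) ->
  ~~ (halfspace l p && halfspace m p).
Proof.
move=> lm nlm l1 mzl lzm; elim/raag_indr: p => [|s p IH].
  by rewrite (negbTE l1).
have side a b : a.1 != b.1 -> ~~ adj a.1 b.1 -> ~~ halfspace b (z a.1) ->
    ~~ halfspace a p -> halfspace a (p * letter s) -> ~~ halfspace b (p * letter s).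
  move=> ab nab bza na pa; have [c [cS e sa]] := half_cross_coset na pa.
  rewrite e -mulgA (@half_coset b a.1) //.
    apply: gen_subM => //; apply: gen_sub_letter.
    by rewrite sa in_star eqxx.
  by rewrite in_star negb_or eq_sym ab.
move: IH; rewrite negb_and => /orP[nl|nm]; apply/negP => /andP[hl hm].
  by have := side l m lm nlm mzl nl hl; rewrite hm.
have := side m l; rewrite eq_sym adj_sym lm nlm hl => /(_ isT isT lzm nm hm).
by [].
Qed.

(** Conjugated by [z l.1], the image of [t] commutes with [l] and has exponent zero on [l.1]; so it
    lies in the link subgroup of [l.1], which preserves the half-space. *)
Lemma half_phi_adj l t p :
  adj l.1 t.1 -> halfspace l (phi (letter t) * p) = halfspace l p.
Proof.
move=> lt1; rewrite /halfspace.
have -> : (z l.1)^-1 * (phi (letter t) * p) =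
    (z l.1)^-1 * phi (letter t) * z l.1 * ((z l.1)^-1 * p).
  by rewrite -!mulgA mulVKg.
apply: begins_link; apply: centralizer_link.
  have := morph_commute phiM (letter_commute lt1); rewrite (phi_letter l).
  set T := phi _; set Z := z _ => h.
  suff : commute (Z^-1 * T * Z) (letter l).
    by move/commute_sym/commute_letterP/commute_sym.
  rewrite /commute; apply: (mulgI Z); apply: (mulIg Z^-1).
  by move: h; rewrite /commute !mulgA mulgV mul1g mulgK => ->.
rewrite !exM phi_ex (additiveV (exM _)) ex_letter.
by case: eqP => [e|]; [move: lt1; rewrite e adj_irr | lia].
Qed.

Lemma half_shift l p : halfspace l (phi (letter l) * p) = ~~ halfspace (linv l) p.
Proof.
rewrite /halfspace phi_letter -[in LHS]mulgA -mulgA mulKg begins_letter //.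
Qed.

Lemma half_linv l p : halfspace l p -> halfspace (linv l) p = false.
Proof. exact: begins_linv. Qed.

Hypothesis half1 : forall l, ~~ halfspace l 1.
Hypothesis half_z : forall l v, l.1 != v -> ~~ adj l.1 v -> ~~ halfspace l (z v).

(** The image of t w lies in the half-space of [t] by [half_shift]. Letters adjacent to [t] do not
    notice the factor [t], and the half-spaces of the remaining letters are disjoint from that of
    [t]. *)
Lemma half_phi (w : raag G) l : halfspace l (phi w) = begins l w.
Proof.
elim/len_ind: w l => [|t w tw IH] l.
  by rewrite (morph1 phiM) begins1; apply/negbTE.
have IHw := IH w (leqnn _).
have ht : halfspace t (phi (letter t * w)) by rewrite phiM half_shift IHw tw.
have bt : begins t (letter t * w) by rewrite begins_letter tw.
have [e|nlt] := eqVneq l.1 t.1.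
  have [->|] : l = t \/ l = linv t.
    by case: l t e {ht bt tw} => u b [v c] /= ->; case: b; case: c; auto.
    by rewrite ht bt.
  by move=> ->; rewrite half_linv // begins_linv.
case la: (adj l.1 t.1); first by rewrite phiM half_phi_adj // begins_adj.
have nb : begins l (letter t * w) = false.
  apply/negP => /begins_excl/(_ bt); rewrite la => /(_ isT) e.
  by move: nlt; rewrite e eqxx.
rewrite nb; apply/negP => hl.
have := @half_disjoint l t (phi (letter t * w)) nlt; rewrite la hl ht /=.
have zl : ~~ halfspace t (z l.1) by apply: half_z; rewrite 1?eq_sym // adj_sym la.
have zt : ~~ halfspace l (z t.1) by apply: half_z; rewrite ?la.
by rewrite half1 zl zt => /(_ isT isT isT isT).
Qed.

(** A preimage of [v] begins with some [l], so [v] lies in the half-space of [l] while 1 does not.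
    The single edge from 1 to [v] crosses the boundary, which gives v = phi(l) and l = v. *)
Lemma phi_id : (forall y, exists x, phi x = y) ->
  forall v, phi (raag_gen v) = raag_gen v.
Proof.
move=> phi_surj v.
have [[l hl]|nh] := pselect (exists l, halfspace l (letter (v, true))).
  have hl' : halfspace l (1 * letter (v, true)) by rewrite mul1g.
  have [e sl] := half_cross (half1 l) hl'.
  by move: e; rewrite -sl mul1g mulg1 => /esym.
have [x xv] := phi_surj (letter (v, true)).
have [x1|nx] := pselect (x = 1).
  move: xv; rewrite x1 (morph1 phiM) => /(congr1 (ex v)).
  by rewrite ex_letter eqxx (additive1 (exM v)).
have [l lx] := begins_neq1 nx; case: nh; exists l.
by rewrite -xv half_phi.
Qed.

End PureMorphism.

(** * Shortening the conjugators; generation by partial conjugations *)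

Section Shortening.
Variables (G : sgraph) (phi : raag G -> raag G) (z : G -> raag G).
Implicit Types (u v w : G) (l m s : G * bool) (x y p q : raag G) (K : {set G}).
Hypothesis phiM : {morph phi : x y / x * y}.
Hypothesis phi_gen : forall v, phi (raag_gen v) = z v * raag_gen v * (z v)^-1.

(** At the letter where the path enters the half-space, [half_cross] trades that letter for a left
    factor [phi (letter l)]; cancelling this factor deletes the letter from the word. *)
Lemma half_delete l p (ws : word G) :
  ~~ halfspace z l p -> halfspace z l (p * \pi_(raag G)%qT ws) ->
  exists2 ws', (size ws' < size ws)%N &
    (phi (letter l))^-1 * (p * \pi_(raag G)%qT ws) = p * \pi_(raag G)%qT ws'.
Proof.
elim: ws p => [|s ws IH] p nl; first by rewrite pi_nil mulg1 (negbTE nl).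
rewrite pi_cons mulgA; case hs: (halfspace z l (p * letter s)) => h.
  have [e _] := half_cross phiM phi_gen nl hs.
  by exists ws; rewrite // e !mulgA mulVg mul1g.
have [ws' sz e] := IH _ (negbT hs) h.
by exists (s :: ws'); rewrite // e pi_cons mulgA.
Qed.

Lemma half_len l p : ~~ halfspace z l 1 -> halfspace z l p ->
  (len ((phi (letter l))^-1 * p) < len p)%N.
Proof.
move=> n1; have [ws -> <-] := len_word p; rewrite -[\pi_(_)%qT ws]mul1g => h.
have [ws' sz ->] := half_delete n1 h.
by rewrite mul1g; apply: leq_ltn_trans (len_pi _) sz.
Qed.

(** The images of [v] and [w] commute, so by [double_coset] z_v^-1 z_w = q p with [q] and [p] in the
    star subgroups of [v] and [w]; neither factor crosses the boundary. *)
Lemma half_adj l v w : adj v w -> l.1 \notin star v -> l.1 \notin star w ->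
  halfspace z l (z v) -> halfspace z l (z w).
Proof.
move=> vw lv lw hv; pose i := (z v)^-1 * z w.
have /double_coset[q [p [qS pS e]]] :
    gen_sub (star w) (i^-1 * raag_gen v * i).
  apply: centralizer_gen.
  have -> : i^-1 * raag_gen v * i = (z w)^-1 * phi (raag_gen v) * z w.
    by rewrite phi_gen /i invgM invgK !mulgA.
  have := morph_commute phiM (gen_commute vw); rewrite [phi (raag_gen w)]phi_gen.
  set T := phi _; set Z := z w => h.
  rewrite /commute; apply: (mulgI Z); apply: (mulIg Z^-1).
  by move: h; rewrite /commute !mulgA mulgV mul1g mulgK => ->.
have zvw : z w * p^-1 = z v * q by rewrite -(mulVKg (z v) (z w)) -/i e mulgA mulgK.
rewrite -(half_coset phiM phi_gen (z w) (gen_subV pS) lw) zvw.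
by rewrite (half_coset phiM phi_gen _ qS).
Qed.

Lemma half_comp l v w :
  w \in component l.1 v -> halfspace z l (z v) -> halfspace z l (z w).
Proof.
rewrite in_comp => /and3P[vl _ /connectP[s + ->]] hv.
elim: s v vl hv => [|v' s IH] v vl hv //= /andP[/and3P[vv' _ v'l] ps].
have sw a : a \notin star l.1 -> l.1 \notin star a.
  by rewrite !in_star eq_sym adj_sym.
by apply: IH => //; apply: half_adj hv; rewrite ?sw.
Qed.

End Shortening.

Lemma sum_ltn (I : finType) (f g : I -> nat) i0 :
  (forall i, f i <= g i)%N -> (f i0 < g i0)%N ->
  (\sum_i f i < \sum_i g i)%N.
Proof.
move=> fg fg0; rewrite (bigD1 i0) //= [in ltnRHS](bigD1 i0) //= -addSn.
by apply: leq_add => //; apply: leq_sum.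
Qed.

Section Generation.
Variables (G : sgraph) (P : aut (raag G) -> Prop).
Hypothesis P1 : P 1.
Hypothesis PM : forall phi l v, P phi -> P (phi * pc l (component l.1 v)).

(** The conjugators [z] are not unique; the total length of a chosen family is what decreases. *)
Lemma pc_generate_bound n (phi : aut (raag G)) (z : G -> raag G) :
  (forall v, phi (raag_gen v) = z v * raag_gen v * (z v)^-1) ->
  (\sum_v len (z v) < n)%N -> P phi.
Proof.
elim: n phi z => // n IH phi z phi_gen; rewrite ltnS => zn.
have phiM := aut_funM phi.
have [[l hl]|n1] := pselect (exists l, halfspace z l 1).
  (* Here [(z l.1)^-1] begins with [l], which commutes with its own generator: appending [l]
     shortens the conjugator and leaves [phi] unchanged. *)
  pose z' v := if v == l.1 then z v * letter l else z v.
  apply: (IH phi z') => [v|].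
    rewrite /z'; case: eqP => // ->; rewrite phi_gen.
    have c : commute (letter l) (raag_gen l.1) by apply/commute_letterP.
    by rewrite -[z l.1 * letter l * _]mulgA c invgM !mulgA mulgK.
  apply: leq_trans zn; apply: (sum_ltn (i0 := l.1)) => [v|].
    rewrite /z'; case: eqP => // ->; apply: ltnW.
    rewrite -lenV invgM -letter_linv -[len (z _)]lenV -len_begins //.
    by move: hl; rewrite /halfspace mulg1.
  rewrite /z' eqxx -lenV invgM -letter_linv -[len (z _)]lenV -len_begins //.
  by move: hl; rewrite /halfspace mulg1.
have half1 l : ~~ halfspace z l 1 by apply/negP => h; apply: n1; exists l.
have [[l [v [lv nlv hv]]]|nz] :=
    pselect (exists l v, [/\ l.1 != v, ~~ adj l.1 v & halfspace z l (z v)]).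
  (* By [half_comp] every [z w] with [w] in [K] lies in the same half-space. Precomposing with the
     inverse partial conjugation multiplies these by [(phi (letter l))^-1], which shortens each of
     them. *)
  pose K := component l.1 v.
  have -> : phi = phi * pc (linv l) K * pc l K.
    by rewrite -mulgA pcV mulVg mulg1.
  apply: PM.
  pose z' w := if w \in K then (phi (letter l))^-1 * z w else z w.
  have hK w : w \in K -> (len ((phi (letter l))^-1 * z w) < len (z w))%N.
    move=> wK; apply: (half_len phiM phi_gen) => //.
    exact: (half_comp phiM phi_gen wK).
  apply: (IH _ z') => [w|].
    rewrite autM pc_genE ?saturated_comp // /z' -/K; case: ifP => _ //.
    rewrite linvK !phiM phi_gen letter_linv (morphV phiM).
    by rewrite invgM invgK !mulgA.
  apply: leq_trans zn; apply: (sum_ltn (i0 := v)) => [w|].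
    by rewrite /z'; case: ifP => // /hK/ltnW.
  have vK : v \in K by rewrite in_comp in_star negb_or eq_sym lv nlv connect0.
  by rewrite /z' vK hK.
suff -> : phi = 1 by [].
apply: aut_ext => v; apply: (phi_id phiM phi_gen half1).
  by move=> l w lw nlw; apply/negP => hw; apply: nz; exists l, w.
by move=> y; exists (aut_inv phi y); rewrite aut_invK.
Qed.

Theorem pc_generate phi : phi \in @pure_symmetric G -> P phi.
Proof.
move=> /asboolP/choice[g phi_g].
apply: (@pc_generate_bound _ phi (fun v => (g v)^-1) _ (ltnSn _)) => v.
by rewrite phi_g conjgE invgK mulgA.
Qed.

End Generation.

(** * Separating intersections of links *)

Section Separation.
Variable G : sgraph.
Implicit Types (a b c u v w x y : G) (l m : G * bool) (K L : {set G}).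

Lemma star_sym u v : (u \in star v) = (v \in star u).
Proof. by rewrite !in_star eq_sym adj_sym. Qed.

Lemma comp_id u v : v \notin star u -> v \in component u v.
Proof. by move=> vu; rewrite in_comp vu connect0. Qed.

Lemma comp_out u v w : v \in component u w -> v \notin star u.
Proof. by rewrite in_comp => /and3P[]. Qed.

Lemma comp_sym u v w : (v \in component u w) = (w \in component u v).
Proof. by rewrite !in_comp (star_rel_sym u w v) andbCA. Qed.

Lemma comp_eq u v w : v \in component u w -> component u v = component u w.
Proof.
rewrite in_comp => /and3P[wu vu wv]; apply/setP => x.
by rewrite !in_comp wu vu (same_connect (@star_rel_sym G u) wv).
Qed.

Lemma comp_star u w : w \in star u -> component u w = set0.
Proof. by move=> wu; apply/setP => v; rewrite in_comp wu in_set0. Qed.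

Lemma saturated_sub u K w : saturated u K -> w \in K -> component u w \subset K.
Proof.
move=> /saturatedP okK wK; apply/subsetP => v; rewrite in_comp => /and3P[_ _].
case/connectP => s + ->; elim: s w wK => [|x s IH] w wK //= /andP[/and3P[wx _ xu]].
by apply: IH; have [_] := okK w wK; apply.
Qed.

(* SIL in terms of complements of stars: the component of [c] in the complement
   of the two links is the intersection of its components for the two stars. *)
Definition separated a b c := [/\ a != b, ~~ adj a b,
  c \notin star a /\ c \notin star b & b \notin component a c /\ a \notin component b c].

Definition full_vertex (U : {set G}) x (xU : x \in U) : full_subgraph U :=
  exist _ x xU.

Lemma connect_full (U : {set G}) a x y (xU : x \in U) (yU : y \in U) :
  (forall z, z \notin star a -> z \in U) -> connect (star_rel a) x y ->
  connect (@adj (full_subgraph U)) (full_vertex xU) (full_vertex yU).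
Proof.
move=> aU /connectP[s]; elim: s x xU => [|x' s IH] x xU /=.
  move=> _ yx; rewrite (_ : full_vertex yU = full_vertex xU) ?connect0 //.
  exact: val_inj.
move=> /andP[/and3P[xx' _ x'a] ps] e; have x'U := aU _ x'a.
by apply: (connect_trans _ (IH x' x'U ps e)); apply: connect1.
Qed.

(** A vertex outside the star of [a] is outside the intersection of the links, so a path from [c] to
    [b] avoiding that star would put [b] in the component of [c]; likewise with [a] and [b]
    exchanged. *)
Lemma has_SIL_separated : has_SIL G -> exists a b c, separated a b c.
Proof.
case=> a [b [ab nab [C]]]; rewrite /graph_minus.
set U := ~: _ => /imsetP[c _ ->] hC; exists a, b, (val c).
have inU z : z \in U = ~~ (adj a z && adj b z) by rewrite !inE.
have aU : a \in U by rewrite inU adj_irr.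
have bU : b \in U by rewrite inU adj_irr andbF.
have hC' (x : full_subgraph U) : connect adj c x -> val x != a /\ val x != b.
  by move=> cx; apply: hC; rewrite !inE.
have aux d e (dU : d \in U) (eU : e \in U) :
    (forall z, z \notin star d -> z \in U) ->
    ~ connect (@adj (full_subgraph U)) c (full_vertex dU) ->
    ~ connect (@adj (full_subgraph U)) c (full_vertex eU) ->
    val c != d -> val c \notin star d /\ e \notin component d (val c).
  move=> sU nd ne cd; split.
    rewrite in_star negb_or cd; apply/negP => dc; apply: nd; apply: connect1.
    by rewrite /= /full_adj /= adj_sym.
  apply/negP; rewrite in_comp => /and3P[_ _ ce]; apply: ne.
  have := connect_full (valP c) eU sU ce.
  by rewrite (_ : full_vertex _ = c) //; apply: val_inj.
have na : ~ connect (@adj (full_subgraph U)) c (full_vertex aU).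
  by move=> /hC'[/=]; rewrite eqxx.
have nb : ~ connect (@adj (full_subgraph U)) c (full_vertex bU).
  by move=> /hC'[/= _]; rewrite eqxx.
have [ca cb] := hC' c (connect0 _ _).
have [|c1 b1] := aux a b aU bU _ na nb ca.
  by move=> z; rewrite in_star inU negb_or => /andP[_ /negbTE->].
have [|c2 a2] := aux b a bU aU _ nb na cb.
  by move=> z; rewrite in_star inU negb_or => /andP[_ /negbTE->]; rewrite andbF.
by split.
Qed.

Lemma separated_has_SIL a b c : separated a b c -> has_SIL G.
Proof.
case=> ab nab [ca cb] [bac abc]; exists a, b; split=> //; rewrite /graph_minus.
set U := ~: _.
have inU z : z \in U = ~~ (adj a z && adj b z) by rewrite !inE.
have cU : c \in U.
  by rewrite inU; move: ca; rewrite in_star negb_or => /andP[_ /negbTE->].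
exists [set x : full_subgraph U in setT | connect adj (full_vertex cU) x].
  by apply/imsetP; exists (full_vertex cU).
(* If [y] were in the star of [d], it would be adjacent to [d] and outside the star of [e]; then
   [y], and with it [d], would lie in the component of [c] for [e]. *)
have step d e x y :
    ~~ adj d e -> e \notin component e c -> d \notin component e c ->
    x \in component d c -> x \in component e c -> adj x y -> ~~ (adj d y && adj e y) ->
    y \notin star d.
  move=> nde _ dec xd xe xy nU; apply/negP; rewrite in_star => /orP[/eqP yd|dy].
    by have := comp_out xd; rewrite in_star adj_sym -yd xy orbT.
  have ye : y \notin star e.
    rewrite in_star negb_or; apply/andP; split.
      by apply: contraNneq nde => <-.
    by apply: contraNN nU => ->; rewrite dy.
  have [_ h] := saturatedP _ _ (saturated_comp e c) _ xe.
  have yc := h y xy ye.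
  have [_ h'] := saturatedP _ _ (saturated_comp e c) _ yc.
  case/negP: dec; apply: h'; rewrite 1?adj_sym // in_star negb_or.
  rewrite adj_sym nde andbT; apply: contraTneq dy => ->.
  by move: ye; rewrite in_star negb_or => /andP[].
suff main (x : full_subgraph U) : connect adj (full_vertex cU) x ->
    val x \in component a c /\ val x \in component b c.
  move=> x; rewrite !inE => /main[xa xb]; split.
    by apply: contraTneq xb => ->.
  by apply: contraTneq xa => ->.
case/connectP => s + ->.
have : val (full_vertex cU) \in component a c /\
       val (full_vertex cU) \in component b c.
  by split; apply: comp_id.
elim: s (full_vertex cU) => [|y s IH] //= v [xa xb] /andP[xy ps].
apply: IH => //; have yU := valP y; rewrite inU in yU.
have nn d : d \notin component d c.
  by apply/negP => /comp_out; rewrite in_star eqxx.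
have ya : val y \notin star a by apply: (step a b _ _ nab (nn b) abc xa xb xy).
have yb : val y \notin star b.
  by apply: (step b a _ _ _ (nn a) bac xb xa xy); rewrite 1?andbC // adj_sym.
have xy' : adj (val v) (val y) by [].
have [_ ha] := saturatedP _ _ (saturated_comp a c) _ xa.
have [_ hb] := saturatedP _ _ (saturated_comp b c) _ xb.
by split; [apply: ha | apply: hb].
Qed.

End Separation.

(** * Commutation of partial conjugations *)

Section Commutation.
Variable G : sgraph.
Implicit Types (a b c u v w x y : G) (l m : G * bool) (K L : {set G}).

Lemma pc_letter l K m : saturated l.1 K ->
  pc l K (letter m) =
    if m.1 \in K then letter l * letter m * letter (linv l) else letter m.
Proof.
move=> okK; have := pc_genE m.1 okK; rewrite !(letterE m).
case: (m.2) => // e; rewrite (morphV (aut_funM (pc l K))) e.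
by case: ifP; rewrite // !invgM letter_linv invgK mulgA.
Qed.

Lemma saturated_base l K : saturated l.1 K -> l.1 \notin K.
Proof. by move=> okK; apply/negP => /(saturatedP _ _ okK)[]; rewrite in_star eqxx. Qed.

Lemma saturated_star u v K : saturated u K -> v \in star u -> v \notin K.
Proof. by move=> okK vu; apply/negP => /(saturatedP _ _ okK)[]; rewrite vu. Qed.

Lemma commute_pc l m K L : saturated l.1 K -> saturated m.1 L ->
  m.1 \notin K -> l.1 \notin L ->
  commute (letter l) (letter m) \/ [disjoint K & L] ->
  commute (pc l K) (pc m L).
Proof.
move=> okK okL mK lL dis; apply: aut_ext => v; rewrite !autM !pc_genE //.
have eK : pc l K (letter m) = letter m by rewrite pc_letter // (negbTE mK).
have eK' : pc l K (letter (linv m)) = letter (linv m).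
  by rewrite pc_letter // (negbTE mK).
have eL : pc m L (letter l) = letter l by rewrite pc_letter // (negbTE lL).
have eL' : pc m L (letter (linv l)) = letter (linv l).
  by rewrite pc_letter // (negbTE lL).
case vL: (v \in L); case vK: (v \in K).
- rewrite !aut_funM eK eK' eL eL' !pc_genE // vL vK.
  case: dis => [lm|/disjointFr/(_ vK)]; last by rewrite vL.
  rewrite !mulgA lm -!mulgA; congr (_ * (_ * (_ * _))).
  by rewrite !letter_linv -!invgM lm.
- by rewrite !aut_funM eK eK' !pc_genE // vL vK.
- by rewrite !aut_funM eL eL' !pc_genE // vL vK.
- by rewrite !pc_genE // vL vK.
Qed.

(** On [m.1] and on all of [L] the map [pc l K] is conjugation by the same letter, so conjugation by
    it leaves [pc m L] unchanged. *)
Lemma commute_pc_sub l m K L : saturated l.1 K -> saturated m.1 L ->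
  m.1 \in K -> l.1 \notin L -> L \subset K -> commute (pc l K) (pc m L).
Proof.
move=> okK okL mK lL LK; apply: aut_ext => v; rewrite !autM !pc_genE //.
have eK : pc l K (letter m) = letter l * letter m * letter (linv l).
  by rewrite pc_letter // mK.
have eK' : pc l K (letter (linv m)) = letter l * letter (linv m) * letter (linv l).
  by rewrite pc_letter // mK.
have eL : pc m L (letter l) = letter l by rewrite pc_letter // (negbTE lL).
have eL' : pc m L (letter (linv l)) = letter (linv l).
  by rewrite pc_letter // (negbTE lL).
case vL: (v \in L).
  have vK := subsetP LK _ vL.
  rewrite vK !aut_funM eK eK' eL eL' !pc_genE // vL vK.
  by rewrite !letter_linv !mulgA !mulgVK.
case vK: (v \in K); last by rewrite !pc_genE // vL vK.
by rewrite !aut_funM eL eL' !pc_genE // vL vK.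
Qed.

Lemma saturated_union u K L : saturated u K -> saturated u L -> saturated u (K :|: L).
Proof.
move=> /saturatedP okK /saturatedP okL; apply/saturatedP => v.
rewrite inE => /orP[vK|vL].
  have [vu h] := okK v vK; split=> // w vw wu; rewrite inE.
  by rewrite (h w vw wu).
have [vu h] := okL v vL; split=> // w vw wu; rewrite inE.
by rewrite (h w vw wu) orbT.
Qed.

Lemma pc_union l K L : saturated l.1 K -> saturated l.1 L -> [disjoint K & L] ->
  pc l (K :|: L) = pc l K * pc l L.
Proof.
move=> okK okL KL; apply: aut_ext => v.
rewrite autM !pc_genE ?saturated_union // inE; case vL: (v \in L).
  have eK : pc l K (letter l) = letter l.
    by rewrite pc_letter // (negbTE (saturated_base okK)).
  have eK' : pc l K (letter (linv l)) = letter (linv l).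
    by rewrite pc_letter // (negbTE (saturated_base okK)).
  by rewrite orbT !aut_funM eK eK' pc_genE // (disjointFl KL vL).
by rewrite pc_genE // orbF.
Qed.

Lemma comp_disjoint u v w :
  v \notin component u w -> [disjoint component u v & component u w].
Proof.
move=> vw; rewrite disjoint_subset; apply/subsetP => x xv; rewrite inE.
apply: contra vw => xw; rewrite -(comp_eq xw) (comp_eq xv).
by apply: comp_id; move: xv; rewrite in_comp => /and3P[].
Qed.

Lemma pc_set0 l : pc l set0 = 1.
Proof. by apply: aut_ext => v; rewrite pc_genE ?saturated0 // inE. Qed.

Lemma pc_pure l K : pc l K \in @pure_symmetric G.
Proof.
apply/asboolP => v; rewrite /= pc_fun_gen /pc_gen; case: ifP => _.
  by exists (letter (linv l)); rewrite conjgE letter_linv invgK mulgA.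
by exists 1; rewrite conjg1.
Qed.

Definition psig_pc l K : PSigma G := PSig (pc_pure l K).

Lemma PSigmaM (f g : PSigma G) : psig_val (f * g) = psig_val f * psig_val g.
Proof. exact: (valM f g). Qed.

Lemma PSigma1 : psig_val (1 : PSigma G) = 1.
Proof. exact: (val1 (PSigma G)). Qed.

Lemma PSigmaV (f : PSigma G) : psig_val f^-1 = (psig_val f)^-1.
Proof. exact: (morphV (f := @psig_val G) PSigmaM). Qed.

Lemma PSigma_inj : injective (@psig_val G).
Proof. exact: val_inj. Qed.

Lemma pure_ex (phi : aut (raag G)) v (p : raag G) : phi \in @pure_symmetric G ->
  ex v (phi p) = ex v p.
Proof.
move=> /asboolP/choice[g phi_g].
apply: (phi_ex (aut_funM phi) (z := fun u => (g u)^-1)) => u.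
by rewrite phi_g conjgE invgK mulgA.
Qed.

End Commutation.

(** * Graphs without separating intersections of links *)

Lemma isomorphic_inverse (H K : groupType) (F : K -> H) :
  {morph F : x y / x * y} -> injective F -> (forall y, exists x, F x = y) ->
  isomorphic H K.
Proof.
move=> FM F_inj /choice[F' F'K].
have F'M : {morph F' : x y / x * y} by move=> x y; apply: F_inj; rewrite FM !F'K.
pose g := isMultiplicative.Build H K F' F'M.
pose g' : {multiplicative H -> K} := HB.pack F' g.
exists g'; exists F => x /=; first exact: F'K.
by apply: F_inj; rewrite F'K.
Qed.

Section Commutators.
Variables (H : groupType) (N : H -> Prop).
Hypothesis N1 : N 1.
Hypothesis NM : forall x y, N x -> N y -> N (x * y).
Hypothesis NV : forall x, N x -> N x^-1.
Hypothesis NJ : forall x y, N x -> N (y * x * y^-1).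

Definition comm_in x y := N (x * y * x^-1 * y^-1).

Lemma comm_in1 y : comm_in 1 y.
Proof. by rewrite /comm_in invg1 mul1g mulg1 mulgV. Qed.

Lemma comm_in_sym x y : comm_in x y -> comm_in y x.
Proof. by move=> /NV; rewrite !invgM !invgK /comm_in !mulgA. Qed.

Lemma comm_inM x x' y : comm_in x y -> comm_in x' y -> comm_in (x * x') y.
Proof.
rewrite /comm_in => xy x'y; have := NM (NJ x x'y) xy.
by rewrite invgM !mulgA !mulgVK.
Qed.

Lemma comm_inV x y : comm_in x y -> comm_in x^-1 y.
Proof.
move=> /comm_in_sym/(NJ x^-1); rewrite /comm_in !invgK.
by rewrite !mulgA !mulgVK.
Qed.

End Commutators.

Section FromNoSIL.
Variable G : sgraph.
Implicit Types (a b c u v w : G) (l m : G * bool) (K L : {set G}).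

Definition is_rep (p : G * G) :=
  (p.2 \notin star p.1) && (root (star_rel p.1) p.2 == p.2).

(* A pair [(a, v)] in [pcv] stands for the component of [v] in the complement
   of the star of [a]; [v] is its canonical representative. *)
Definition pcv := {p : G * G | is_rep p}.
Implicit Types (d e : pcv).

Definition base d : G := (val d).1.
Definition repv d : G := (val d).2.
Definition blk d : {set G} := component (base d) (repv d).

Lemma repv_out d : repv d \notin star (base d).
Proof. by have /andP[] := valP d. Qed.

Lemma repv_blk d : repv d \in blk d.
Proof. exact: comp_id (repv_out d). Qed.

Lemma blk_ok d : saturated (base d) (blk d).
Proof. exact: saturated_comp. Qed.

Lemma blk_eq d e v : base d = base e -> v \in blk d -> v \in blk e -> d = e.
Proof.
move=> de; rewrite !in_comp -/(blk _) de => /and3P[_ _ dv] /and3P[_ _ ev].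
have /andP[_ /eqP rd] := valP d; have /andP[_ /eqP re] := valP e.
have rr : repv d = repv e.
  rewrite /repv -rd -re -/(base d) -/(base e) de.
  apply/(rootP (@star_rel_sym G _)); apply: connect_trans dv _.
  by rewrite star_rel_sym.
apply: val_inj; move: de rr; rewrite /base /repv.
by case: (val d) (val e) => [? ?] [? ?] /= -> ->.
Qed.

Lemma comp_blk a v : v \notin star a -> exists d, base d = a /\ component a v = blk d.
Proof.
move=> va; pose r := root (star_rel a) v.
have rv : r \in component a v.
  have vr : connect (star_rel a) v r by exact: connect_root.
  rewrite in_comp va vr andbT /=; case/connectP: vr => s.
  case/lastP: s => [_ ->//|s x]; rewrite rcons_path last_rcons => /andP[_ +] ->.
  by case/and3P.
have rep : is_rep (a, r).
  by rewrite /is_rep /= (comp_out rv) /r (root_root (@star_rel_sym G a)) eqxx.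
by exists (Sub (a, r) rep); split; rewrite // /blk /base /repv /= (comp_eq rv).
Qed.

Definition padj : rel pcv :=
  fun d e => (d != e) && ~~ ((base e \in blk d) && (base d \in blk e)).

Lemma padj_sym : symmetric padj.
Proof. by move=> d e; rewrite /padj eq_sym andbC andbC; congr andb; rewrite andbC. Qed.

Lemma padj_irr : irreflexive padj.
Proof. by move=> d; rewrite /padj eqxx. Qed.

Definition pcG := SGraph padj_sym padj_irr.

Lemma base_blk d e : base d = base e -> base d \notin blk e.
Proof. by move=> ->; apply: saturated_base (_, true) _ (blk_ok e). Qed.

Lemma padj_base d e : base d = base e -> d != e -> padj d e.
Proof. by move=> de nde; rewrite /padj nde negb_and (base_blk de) orbT. Qed.

Hypothesis nosep : forall a b c, ~ separated a b c.

Lemma nosepP a b c : a != b -> ~~ adj a b -> c \notin star a -> c \notin star b ->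
  b \in component a c \/ a \in component b c.
Proof.
move=> ab nab ca cb; case ba: (b \in component a c); first by left.
case abc: (a \in component b c); first by right.
by case: (@nosep a b c); split; rewrite ?ba ?abc.
Qed.

Definition psig_gen d : PSigma G := psig_pc (base d, true) (blk d).

(** For distinct non-adjacent bases, the absence of separation makes two blocks nested if exactly
    one of them contains the base of the other, and disjoint if neither does. *)
Lemma psig_gen_commute d e : padj d e -> commute (psig_gen d) (psig_gen e).
Proof.
move=> /andP[nde nn]; apply: PSigma_inj; rewrite !PSigmaM /=.
have okd := blk_ok d; have oke := blk_ok e.
have disj c : c \in blk d -> c \in blk e -> base d != base e ->
    ~~ adj (base d) (base e) -> base e \in blk d \/ base d \in blk e.
  move=> cd ce bde nbde; have := nosepP bde nbde (comp_out cd) (comp_out ce).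
  by rewrite (comp_eq cd) (comp_eq ce).
case ade: (adj (base d) (base e)).
  apply: commute_pc => //=.
  - by apply: saturated_star okd _; rewrite in_star ade orbT.
  - by apply: saturated_star oke _; rewrite in_star adj_sym ade orbT.
  - by left; apply: letter_commute.
have [bde|bde] := eqVneq (base d) (base e).
  apply: commute_pc => //=.
  - by rewrite base_blk.
  - by rewrite base_blk.
  - by left; rewrite bde.
have sub d1 e1 : base d1 != base e1 -> ~~ adj (base d1) (base e1) ->
    base e1 \in blk d1 -> base d1 \notin blk e1 -> blk e1 \subset blk d1.
  move=> b1 a1 ed de; apply/subsetP => y ye.
  have yd : y \notin star (base d1).
    rewrite in_star; apply/norP; split; first by apply: contraNneq de => <-.
    apply: contra de => dy; have [_ h] := saturatedP _ _ (blk_ok e1) _ ye.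
    by apply: h; rewrite 1?adj_sym // in_star negb_or b1 adj_sym.
  have := nosepP b1 a1 yd (comp_out ye); rewrite (comp_eq ye) -/(blk e1) (negbTE de).
  by case=> //; rewrite comp_sym (comp_eq ed).
case ed: (base e \in blk d) nn; case de: (base d \in blk e) => // _.
- by apply: commute_pc_sub => //=; rewrite ?de // sub ?ade ?ed ?de.
- apply/commute_sym/commute_pc_sub => //=; rewrite ?ed //.
  by rewrite sub ?de ?ed // 1?eq_sym // adj_sym ade.
- apply: commute_pc => //=; rewrite ?ed ?de //; right.
  rewrite disjoint_subset; apply/subsetP => y yd; rewrite inE; apply/negP => ye.
  by case: (disj y yd ye bde); rewrite ?ade ?ed ?de.
Qed.

Definition pc_map : raag pcG -> PSigma G := raag_lift (G := pcG) psig_gen.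

Lemma pc_mapM : {morph pc_map : x y / x * y}.
Proof. by apply: liftM => d e; exact: psig_gen_commute. Qed.

Lemma pc_map_letter (m : pcG * bool) :
  psig_val (pc_map (letter m)) = pc (base m.1, m.2) (blk m.1).
Proof.
rewrite /pc_map lift_letter; last by move=> d e; exact: psig_gen_commute.
rewrite /letterev; case: m => d [] //=.
exact/esym/(pcV (base d, true)).
Qed.

Lemma pc_map_surj phi : exists x, pc_map x = phi.
Proof.
suff [x xphi] : exists x, psig_val (pc_map x) = psig_val phi.
  by exists x; apply: PSigma_inj.
apply: (pc_generate (P := fun f => exists x, psig_val (pc_map x) = f)).
- by exists 1; rewrite (morph1 pc_mapM) PSigma1.
- move=> f l v [x <-]; case vl: (v \in star l.1).
    by exists x; rewrite comp_star // pc_set0 mulg1.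
  have [d [dl ->]] := comp_blk (negbT vl).
  exists (x * letter ((d, l.2) : pcG * bool)).
  by rewrite pc_mapM PSigmaM pc_map_letter /= dl -surjective_pairing.
- exact: valP phi.
Qed.

(* The image of [g] under [inn] maps to the inner automorphism of [g]. *)
Definition inn_gen a : raag pcG := \prod_(d : pcv | base d == a) raag_gen (d : pcG).

Lemma pcgen_commute d e : base d = base e ->
  commute (raag_gen (d : pcG)) (raag_gen (e : pcG)).
Proof.
move=> de; have [->|nde] := eqVneq d e; first by [].
by apply: gen_commute; apply: padj_base.
Qed.

Lemma out_commute d e : base e \notin blk d ->
  commute (raag_gen (d : pcG)) (raag_gen (e : pcG)).
Proof.
move=> ed; have [->|nde] := eqVneq d e; first by [].
by apply: gen_commute; rewrite /= /padj nde (negbTE ed).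
Qed.

Lemma inn_gen_comm a b : adj a b -> commute (inn_gen a) (inn_gen b).
Proof.
move=> ab; apply: commute_prod => e /eqP eb; apply: commute_sym.
apply: commute_prod => d /eqP da; apply: out_commute.
by apply: saturated_star (blk_ok e) _; rewrite eb da in_star adj_sym ab orbT.
Qed.

Definition inn : raag G -> raag pcG := raag_lift inn_gen.

Lemma innM : {morph inn : x y / x * y}.
Proof. by apply: liftM; apply: inn_gen_comm. Qed.

Lemma inn_genE a : inn (raag_gen a) = inn_gen a.
Proof. by apply: lift_gen; apply: inn_gen_comm. Qed.

(** All other factors of [inn_gen (base d)] commute with [x], so in conjugations of [x] the
    generator [d] may be traded for [inn_gen (base d)]. *)
Lemma inn_gen_split d (x : raag pcG) :
  (forall e, base e = base d -> e != d -> commute (raag_gen (e : pcG)) x) ->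
  commute ((raag_gen (d : pcG))^-1 * inn_gen (base d)) x.
Proof.
move=> h; rewrite /inn_gen -big_filter.
set s := [seq _ <- _ | _].
have ds : d \in s by rewrite mem_filter eqxx mem_index_enum.
have us : uniq s by rewrite filter_uniq // index_enum_uniq.
have sb e : e \in s -> base e = base d by rewrite mem_filter => /andP[/eqP].
case/splitPr: ds us sb => s1 s2 us sb; rewrite big_cat big_cons /=.
have c1 : commute (raag_gen (d : pcG)) (\prod_(e <- s1) raag_gen (e : pcG)).
  rewrite big_seq; apply: commute_prod => e es; apply: pcgen_commute.
  by rewrite (sb e) // mem_cat es.
rewrite [X in _ * X]mulgA -c1 -mulgA mulKg -big_cat big_seq.
apply/commute_sym; apply: commute_prod => e es; apply/commute_sym.
apply: h.
  by apply: sb; move: es; rewrite !mem_cat inE => /orP[]->; rewrite ?orbT.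
apply: contraTneq es => ->; move: us; rewrite cat_uniq /=.
case/and3P=> _ /norP[/negbTE d1 _] /andP[/negbTE d2 _].
by rewrite mem_cat [_ \in s1]d1 d2.
Qed.

(** If [a] lies in the block of [d], conjugating [inn_gen a] by [d] amounts to conjugating it by
    [inn_gen (base d)]; otherwise [d] commutes with [inn_gen a]. Hence the image of [inn] is
    normal. *)
Lemma inn_conj_gen (m : pcG * bool) a : exists h,
  inn h = letter m * inn_gen a * (letter m)^-1.
Proof.
case: m => d t; pose c := raag_gen (d : pcG); pose b := base d.
case ad: (a \in blk d); last first.
  exists (raag_gen a); rewrite inn_genE.
  have /commute_sym ca : commute (letter ((d, t) : pcG * bool)) (inn_gen a).
    apply/commute_letterP/commute_prod => e /eqP ea; apply: out_commute.
    by rewrite ea ad.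
  by rewrite -ca mulgK.
have Kc : commute (c^-1 * inn_gen b) (inn_gen a).
  apply: inn_gen_split => e eb ned; apply: commute_prod => e' /eqP ea.
  apply: out_commute; rewrite ea; apply: contra ned => ae.
  by rewrite (blk_eq eb ae ad).
have cb : commute c (inn_gen b).
  by apply: commute_prod => e /eqP eb; apply: pcgen_commute.
have [k [bk ka ck]] : exists k,
    [/\ inn_gen b = c * k, commute k (inn_gen a) & commute c k].
  exists (c^-1 * inn_gen b); split; rewrite ?mulVKg //.
  by apply: commuteM => //; apply: commuteV.
case: t.
  exists (raag_gen b * raag_gen a * (raag_gen b)^-1).
  rewrite !innM (morphV innM) !inn_genE letter_true -/c.
  by rewrite bk invgM -(mulgA c) ka !mulgA mulgK.
exists ((raag_gen b)^-1 * raag_gen a * raag_gen b).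
rewrite !innM (morphV innM) !inn_genE letter_false -/c invgK.
by rewrite bk ck invgM -!mulgA (mulgA (inn_gen a)) -ka -!mulgA mulKg.
Qed.

Definition in_inn y := exists g, inn g = y.

Lemma in_innM x y : in_inn x -> in_inn y -> in_inn (x * y).
Proof. by move=> [g <-] [h <-]; exists (g * h); rewrite innM. Qed.

Lemma in_innV x : in_inn x -> in_inn x^-1.
Proof. by move=> [g <-]; exists g^-1; rewrite (morphV innM). Qed.

Lemma in_inn1 : in_inn 1.
Proof. by exists 1; rewrite (morph1 innM). Qed.

Lemma in_innJ x y : in_inn x -> in_inn (y * x * y^-1).
Proof.
elim/raag_ind: y x => [|m y IH] x xN; first by rewrite mul1g invg1 mulg1.
have -> : letter m * y * x * (letter m * y)^-1 =
    letter m * (y * x * y^-1) * (letter m)^-1.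
  by rewrite invgM !mulgA.
case: (IH x xN) => g <-; elim/raag_ind: g => [|l g IHg].
  by rewrite (morph1 innM) mulg1 mulgV; apply: in_inn1.
rewrite innM.
have -> : letter m * (inn (letter l) * inn g) * (letter m)^-1 =
    letter m * inn (letter l) * (letter m)^-1 * (letter m * inn g * (letter m)^-1).
  by rewrite !mulgA mulgVK.
apply: in_innM => //; have [k ek] := inn_conj_gen m l.1.
case lb: l.2; first by exists k; rewrite (letterE l) lb inn_genE.
by exists k^-1; rewrite (letterE l) lb !(morphV innM) ek inn_genE !invgM invgK mulgA.
Qed.

Let N1 := in_inn1.
Let NM := in_innM.
Let NV := in_innV.
Let NJ := in_innJ.

(** When the two do not obviously commute, [c] can be replaced by [inn_gen (base d)], and a
    commutator with an element of a normal subgroup lies in that subgroup. *)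
Lemma comm_in_gen d e :
  comm_in in_inn (raag_gen (d : pcG)) (raag_gen (e : pcG)).
Proof.
set c := raag_gen (d : pcG); set c' := raag_gen (e : pcG).
case ed: (base e \in blk d); last first.
  have cc' : commute c c' by apply: out_commute; rewrite ed.
  by rewrite /comm_in cc' mulgK mulgV.
have Kc : commute (c^-1 * inn_gen (base d)) c'.
  apply: inn_gen_split => f fd nfd; apply: out_commute.
  by apply: contra nfd => ef; rewrite (blk_eq fd ef ed).
rewrite /comm_in.
have -> : c * c' * c^-1 * c'^-1 =
    inn_gen (base d) * (c' * (inn_gen (base d))^-1 * c'^-1).
  have [k [-> kc']] : exists k, inn_gen (base d) = c * k /\ commute k c'.
    by exists (c^-1 * inn_gen (base d)); rewrite mulVKg.
  by rewrite invgM !mulgA -(mulgA c k) kc' !mulgA mulgK.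
rewrite -inn_genE; apply: in_innM; first by eexists.
by apply: in_innJ; apply: in_innV; eexists.
Qed.

Lemma comm_in_ind x z :
  (forall d, comm_in in_inn (raag_gen (d : pcG)) z) -> comm_in in_inn x z.
Proof.
move=> h; elim/raag_ind: x => [|m x IHx]; first exact: comm_in1.
by apply: comm_inM => //; rewrite letterE; case: m.2 => //; apply: comm_inV.
Qed.

Lemma comm_in_all x y : comm_in in_inn x y.
Proof.
apply: comm_in_ind => d; apply: comm_in_sym => //; apply: comm_in_ind => e.
exact: comm_in_gen.
Qed.

(** Used to find the inverse of the first letter later in a word of exponent zero. *)
Lemma ex_sign (w : word pcG) (m : pcG * bool) : linv m \notin w ->
  (0 <= if m.2 then ex m.1 (\pi_(raag pcG)%qT w)
        else - ex m.1 (\pi_(raag pcG)%qT w))%Z.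
Proof.
elim: w => [|l w IH]; first by rewrite pi_nil (additive1 (exM _)); case: m.2.
rewrite in_cons negb_or => /andP[ml /IH]; rewrite pi_cons (exM m.1) ex_letter.
move: ml; case: (l.1 =P m.1) => [e|_] ml h; last by case: (m.2) h => /= h; lia.
have -> : l.2 = m.2.
  case: l m e ml {IH h} => [v b] [u b'] /= ->.
  by rewrite /linv /= xpair_eqE eqxx; case: b; case: b'.
by case: (m.2) h => h; lazy iota in h |- *; lia.
Qed.

(** The inverse of the first letter occurs later in the word, and m w1 m^-1 w2 = [m, w1] w1 w2. The
    commutator lies in the image of [inn], and the rest is shorter. *)
Lemma ex0_in_inn x : (forall d, ex (d : pcG) x = 0%Z) -> in_inn x.
Proof.
rewrite -[x]reprK; move: (repr x) => w {x}.
have [n] := ubnP (size w); elim: n w => // n IH [|m w] /=.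
  by move=> _ _; apply: in_inn1.
rewrite ltnS => wn ew.
have mw : linv m \in w.
  apply/negPn/negP => /ex_sign; move: (ew m.1).
  by rewrite pi_cons (exM (m.1 : pcG)) ex_letter eqxx; case: m.2; lia.
case/splitPr: mw wn ew => w1 w2 wn ew.
have e : \pi_(raag pcG)%qT (m :: w1 ++ linv m :: w2) =
    letter m * \pi_(raag pcG)%qT w1 * (letter m)^-1 * (\pi_(raag pcG)%qT w1)^-1 *
    \pi_(raag pcG)%qT (w1 ++ w2).
  by rewrite pi_cons !pi_cat pi_cons letter_linv !mulgA mulgVK.
rewrite e; apply: in_innM; first exact: comm_in_all.
apply: IH; first by move: wn; rewrite !size_cat /= addnS; apply: leq_trans.
move=> d; have h := ew d.
rewrite e !(exM (d : pcG)) !(additiveV (exM (d : pcG))) in h.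
suff : ex (d : pcG) (\pi_(raag pcG)%qT (w1 ++ w2)) = 0%Z by [].
lia.
Qed.

(** The exponent of [d] is visible in the automorphism, because [d] is the only generator with its
    base whose block contains [repv d]. *)
Lemma pc_map_conj d (x : raag pcG) : exists z,
  psig_val (pc_map x) (raag_gen (repv d)) = z * raag_gen (repv d) * z^-1 /\
  ex (base d) z = ex (d : pcG) x.
Proof.
elim/raag_ind: x => [|m x [z [zE ez]]].
  exists 1; rewrite (morph1 pc_mapM) PSigma1 (additive1 (exM _)).
  by rewrite (additive1 (exM _)) invg1 mul1g mulg1.
rewrite pc_mapM PSigmaM autM zE pc_map_letter; set f := pc _ _.
have fV : f z^-1 = (f z)^-1 by rewrite (morphV (aut_funM f)).
have fz : ex (base d) (f z) = ex (d : pcG) x.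
  by rewrite pure_ex ?ez //; apply: pc_pure.
have fg : f (raag_gen (repv d)) = if repv d \in blk m.1 then
    letter (base m.1, m.2) * raag_gen (repv d) * letter (linv (base m.1, m.2))
    else raag_gen (repv d).
  by rewrite pc_genE //=; apply: blk_ok.
have [dm|ndm] := eqVneq d m.1.
  exists (f z * letter (base m.1, m.2)); split.
    by rewrite !aut_funM fV fg -dm repv_blk letter_linv invgM !mulgA.
  by rewrite (exM (base d)) (exM (d : pcG)) fz !ex_letter -dm !eqxx Z.add_comm.
case rm: (repv d \in blk m.1) fg => fg.
  exists (f z * letter (base m.1, m.2)); split.
    by rewrite !aut_funM fV fg letter_linv invgM !mulgA.
  rewrite (exM (base d)) (exM (d : pcG)) fz !ex_letter eq_sym [m.1 == _]eq_sym.
  rewrite (negbTE ndm); case: eqP => [e|_]; last exact: Z.add_comm.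
  by case/eqP: ndm; apply: blk_eq e (repv_blk d) rm.
exists (f z); split; first by rewrite !aut_funM fV fg.
by rewrite (exM (d : pcG)) fz ex_letter eq_sym (negbTE ndm).
Qed.

(** The blocks with base [a] partition the complement of the star of [a], and conjugation by [a] is
    trivial on that star. *)
Lemma pc_map_inn_gen a y : psig_val (pc_map (inn (raag_gen a))) y =
  raag_gen a * y * (raag_gen a)^-1.
Proof.
have cM : {morph (fun y => raag_gen a * y * (raag_gen a)^-1) : x y / x * y}.
  by move=> p q; rewrite !mulgA mulgVK.
move: y; apply: (raag_ext (aut_funM _) cM) => v.
have prodE (s : seq pcv) : uniq s -> {in s, forall d, base d = a} ->
    psig_val (pc_map (\prod_(d <- s) raag_gen (d : pcG))) (raag_gen v) =
    if has (fun d => v \in blk d) s then raag_gen a * raag_gen v * (raag_gen a)^-1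
    else raag_gen v.
  elim: s => [|d s IH] /=.
    by move=> _ _; rewrite big_nil (morph1 pc_mapM) PSigma1.
  case/andP=> ds us sa; rewrite big_cons pc_mapM PSigmaM autM IH //; last first.
    by move=> e es; apply: sa; rewrite inE es orbT.
  have da : base d = a by apply: sa; rewrite mem_head.
  have -> : psig_val (pc_map (raag_gen (d : pcG))) = pc (a, true) (blk d).
    by rewrite -da; exact: (pc_map_letter ((d, true) : pcG * bool)).
  set f := pc _ _; have okd : saturated a (blk d) by rewrite -da; apply: blk_ok.
  have fv : f (raag_gen v) = if v \in blk d
      then raag_gen a * raag_gen v * (raag_gen a)^-1 else raag_gen v.
    by rewrite pc_genE // letter_linv.
  have fa : f (raag_gen a) = raag_gen a.
    by rewrite pc_genE // (negbTE (saturated_base (l := (a, true)) okd)).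
  case vs: (has _ s); last by rewrite orbF fv.
  rewrite orbT !aut_funM (morphV (aut_funM f)) fa fv.
  case: ifP => // vd; case/hasP: vs => e es ve; case/negP: ds.
  have ea : base e = a by apply: sa; rewrite inE es orbT.
  by rewrite (blk_eq _ vd ve) ?da ?ea.
rewrite inn_genE /inn_gen -big_filter prodE; first last.
- by move=> d; rewrite mem_filter => /andP[/eqP].
- by rewrite filter_uniq // index_enum_uniq.
case va: (v \in star a).
  case: hasP => // _; move: va; rewrite in_star => /orP[/eqP->|av].
    by rewrite mulgK.
  by rewrite (gen_commute av) mulgK.
case: hasP => // -[]; have [d [da dv]] := comp_blk (negbT va).
exists d; first by rewrite mem_filter da eqxx mem_index_enum.
by rewrite -dv comp_id ?va.
Qed.

Lemma pc_map_inn g y : psig_val (pc_map (inn g)) y = g * y * g^-1.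
Proof.
elim/raag_ind: g y => [|l g IH] y.
  by rewrite (morph1 innM) (morph1 pc_mapM) PSigma1 invg1 mul1g mulg1.
rewrite innM pc_mapM PSigmaM autM IH.
have -> : letter l * g * y * (letter l * g)^-1 =
    letter l * (g * y * g^-1) * (letter l)^-1.
  by rewrite invgM !mulgA.
move: (g * y * g^-1) => p; rewrite letterE; case: l.2; first exact: pc_map_inn_gen.
rewrite (morphV innM) (morphV pc_mapM) PSigmaV invgK.
set f := psig_val _; apply: (can_inj (aut_funK f)); rewrite -autM mulgV.
by rewrite pc_map_inn_gen !mulgA mulgV mul1g mulgK.
Qed.

(** Every letter of a central element lies in the star of every vertex, so there are no blocks with
    that base and the product [inn_gen] is empty. *)
Lemma inn_central g : (forall v, commute g (raag_gen v)) -> inn g = 1.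
Proof.
elim/len_ind: g => [|l g lg IH] gC; first exact: morph1 innM.
have lS v : l.1 \in star v.
  by apply: (commute_begins (gC v)); rewrite begins_letter lg.
have l1 : inn (letter l) = 1.
  have e1 : inn (raag_gen l.1) = 1.
    rewrite inn_genE /inn_gen big_pred0 // => d; apply/eqP => dl.
    by have := repv_out d; rewrite dl star_sym lS.
  by rewrite letterE; case: l.2; rewrite ?(morphV innM) e1 ?invg1.
rewrite innM l1 mul1g; apply: IH => // v.
have -> : g = (letter l)^-1 * (letter l * g) by rewrite mulKg.
apply: commute_sym; apply: commuteM; last exact: commute_sym.
apply: commuteV; apply: commute_sym; apply: (@gen_sub_commute _ (star v)) => //.
exact: gen_sub_letter.
Qed.

Lemma pc_map_eq1 x : pc_map x = 1 -> x = 1.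
Proof.
move=> x1.
have [d|g gx] := @ex0_in_inn x.
  (* The conjugator [z] commutes with [repv d], whose star does not contain [base d]. *)
  have [z [zE <-]] := pc_map_conj d x.
  apply: (gen_sub_ex _ (_ : base d \notin star (repv d))).
    apply: centralizer_gen; apply: (mulIg z^-1).
    by rewrite -zE x1 PSigma1 mulgK.
  by rewrite star_sym repv_out.
rewrite -gx; apply: inn_central => v.
by apply: (mulIg g^-1); rewrite -pc_map_inn gx x1 PSigma1 mulgK.
Qed.

Lemma no_separation_is_raag : is_raag (PSigma G).
Proof.
exists pcG; apply: (isomorphic_inverse pc_mapM _ pc_map_surj) => x y xy.
apply: divg1_eq; apply: pc_map_eq1.
by rewrite pc_mapM (morphV pc_mapM) xy mulgV.
Qed.

End FromNoSIL.

(** * Resonance *)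

Section Resonance.
Variable H : groupType.
Implicit Types (al be : H -> Z) (g h : H).

(* A necessary condition for the cup product of [al] and [be] to vanish, which
   depends only on commuting pairs; [resonant] is the corresponding version of
   membership in the first resonance variety. *)
Definition cup0 al be :=
  forall g h, commute g h -> (al g * be h = al h * be g)%Z.

Definition indep al be := exists g h, (al g * be h <> al h * be g)%Z.

Definition resonant al := exists be, [/\ additive be, cup0 al be & indep al be].

Lemma additive_comb al be s t : additive al -> additive be ->
  additive (fun g => s * al g + t * be g)%Z.
Proof. by move=> alM beM x y; rewrite alM beM; lia. Qed.

End Resonance.

Section PSigmaResonance.
Variable G : sgraph.
Implicit Types (a b c d u v w : G) (K L : {set G}).

Definition pconj a K : PSigma G := psig_pc (a, true) K.

Lemma pconj_commute a K d L :
  commute (pc (a, true) K) (pc (d, true) L) -> commute (pconj a K) (pconj d L).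
Proof. by move=> h; apply: PSigma_inj; rewrite !PSigmaM. Qed.

Lemma pconj_union a K L : saturated a K -> saturated a L -> [disjoint K & L] ->
  pconj a (K :|: L) = pconj a K * pconj a L.
Proof.
by move=> okK okL KL; apply: PSigma_inj; rewrite PSigmaM; apply: pc_union.
Qed.

Lemma pconj_commute_base a K L :
  saturated a K -> saturated a L -> commute (pconj a K) (pconj a L).
Proof.
move=> okK okL; apply: pconj_commute; apply: commute_pc => //=.
- exact: (saturated_base (l := (a, true))).
- exact: (saturated_base (l := (a, true))).
- by left.
Qed.

Lemma additive_pconj_eq0 (be : PSigma G -> Z) : additive be ->
  (forall d w, w \notin star d -> be (pconj d (component d w)) = 0%Z) ->
  forall x, be x = 0%Z.
Proof.
move=> beM be0 x.
suff [y [yx y0]] : exists y, psig_val y = psig_val x /\ be y = 0%Z.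
  by rewrite -(PSigma_inj yx).
apply: (pc_generate (P := fun f => exists y, psig_val y = f /\ be y = 0%Z)).
- by exists 1; rewrite PSigma1 (additive1 beM).
- move=> f l w [y [<- y0]]; case wl: (w \in star l.1).
    by exists y; rewrite comp_star // pc_set0 mulg1.
  exists (y * psig_pc l (component l.1 w)); rewrite PSigmaM beM y0; split=> //.
  have bl := be0 l.1 w (negbT wl).
  case: l wl bl => v [] wl bl; first by rewrite bl.
  have -> : psig_pc (v, false) (component v w) = (pconj v (component v w))^-1.
    by apply: PSigma_inj; rewrite PSigmaV /= -pcV.
  by rewrite (additiveV beM) bl.
- exact: valP x.
Qed.

Lemma comp_avoid a d y v : d \notin star a -> d \notin component a y ->
  v \in component a y -> v \notin star d.
Proof.
move=> da dy vy; have [va h] := saturatedP _ _ (saturated_comp a y) _ vy.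
rewrite in_star; apply/norP; split; first by apply: contraNneq dy => <-.
by apply: contra dy => dv; apply: h; rewrite // adj_sym.
Qed.

(** By [comp_avoid] the component for [a] never meets the star of [d], so its paths survive in the
    complement of that star. *)
Lemma comp_subset a d y : d \notin star a -> d \notin component a y ->
  y \notin star a -> component a y \subset component d y.
Proof.
move=> da dy ya; have yd := comp_avoid da dy (comp_id ya).
suff ok : saturated a (component a y :&: component d y).
  have yT : y \in component a y :&: component d y by rewrite inE !comp_id.
  by apply: subset_trans (saturated_sub ok yT) (subsetIr _ _).
apply/saturatedP => v; rewrite inE => /andP[vy vd].
have [va h] := saturatedP _ _ (saturated_comp a y) _ vy; split=> // w vw wa.
have wy := h w vw wa; rewrite inE wy.
have [_ h'] := saturatedP _ _ (saturated_comp d y) _ vd.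
by apply: h' => //; apply: comp_avoid wy.
Qed.

Section Vanishing.
Variables (be : PSigma G -> Z) (a : G).
Hypothesis beM : additive be.

(** Each generator at [d] is shown to commute with one of the three elements at [a], or to be a
    quotient of elements that do. *)
Lemma vanish_outside v v' d w :
  v \notin star a -> v' \notin star a -> v' \notin component a v ->
  (forall h, commute h (pconj a (component a v)) -> be h = 0%Z) ->
  (forall h, commute h (pconj a (component a v')) -> be h = 0%Z) ->
  (forall h, commute h (pconj a (component a v :|: component a v')) -> be h = 0%Z) ->
  a != d -> ~~ adj a d -> d \notin component a v' -> w \notin star d ->
  be (pconj d (component d w)) = 0%Z.
Proof.
set K := component a v; set K' := component a v' => va v'a v'v kK kK' kU ad nad dK' wd.
have okK : saturated a K := saturated_comp a v.
have okK' : saturated a K' := saturated_comp a v'.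
have da : d \notin star a by rewrite in_star negb_or eq_sym ad.
have KK' : [disjoint K & K'].
  by rewrite disjoint_sym; apply: comp_disjoint.
have sub : K' \subset component d v' by apply: comp_subset.
(* Here the block [component d x] misses [a]. It is either disjoint from [K'] or equal to it; in the
   latter case (a, K) or (a, K union K') does the job, according to whether [d] lies in [K]. *)
have out x : x \notin star d -> a \notin component d x ->
    be (pconj d (component d x)) = 0%Z.
  move=> xd ax; have okL := saturated_comp d x.
  have [dis|] := boolP [disjoint component d x & K'].
    apply: kK'; apply: pconj_commute; apply/commute_sym/commute_pc => //=.
    by right; rewrite disjoint_sym.
  move=> /pred0Pn[y /andP[/= yx yK']].
  have ya := comp_out yK'; have yd := comp_out yx.
  have LK' : component d x = K'.
    rewrite /K' -(comp_eq yK') -(comp_eq yx); apply/eqP; rewrite eqEsubset.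
    rewrite !comp_subset ?(comp_eq yK') ?(comp_eq yx) //.
    by rewrite star_sym.
  have [dK|dK] := boolP (d \in K).
    apply: kU; apply: pconj_commute; apply/commute_sym/commute_pc_sub => //=.
    - exact: saturated_union.
    - by rewrite inE dK.
    - by rewrite LK' subsetUr.
  apply: kK; apply: pconj_commute; apply/commute_sym/commute_pc => //=.
  by right; rewrite LK'.
have [aL|aL] := boolP (a \in component d w); last exact: out.
have okL := saturated_comp d w.
have [v'L|v'L] := boolP (v' \in component d w).
  apply: kK'; apply: pconj_commute; apply: commute_pc_sub => //=.
  by rewrite -(comp_eq v'L).
have v'd : v' \notin star d by apply: comp_avoid (comp_id v'a).
have dis : [disjoint component d w & component d v'].
  by rewrite disjoint_sym; apply: comp_disjoint.
(* The block contains [a] but not [K']. Adding the block of [v'] gives a set containing both, whose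
   partial conjugation commutes with (a, K'); the added factor is covered by [out]. *)
have := beM (pconj d (component d w)) (pconj d (component d v')).
rewrite -pconj_union ?saturated_comp // (out v') //; last by rewrite (disjointFr dis aL).
rewrite kK'; first by lia.
apply: pconj_commute; apply: commute_pc_sub => //=.
- exact: saturated_union okL (saturated_comp d v').
- by rewrite inE aL.
- by apply: subset_trans sub _; apply: subsetUr.
Qed.

Lemma vanish v v' :
  v \notin star a -> v' \notin star a -> v' \notin component a v ->
  (forall h, commute h (pconj a (component a v)) -> be h = 0%Z) ->
  (forall h, commute h (pconj a (component a v')) -> be h = 0%Z) ->
  (forall h, commute h (pconj a (component a v :|: component a v')) -> be h = 0%Z) ->
  forall x, be x = 0%Z.
Proof.
move=> va v'a v'v kK kK' kU; apply: additive_pconj_eq0 => // d w wd.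
have okL := saturated_comp d w; have okK := saturated_comp a v.
have [<-|ad] := eqVneq a d.
  by apply: kK; apply: pconj_commute_base okK; exact: saturated_comp.
case nad: (adj a d).
  apply: kK; apply: pconj_commute; apply/commute_sym/commute_pc => //=.
  - by apply: saturated_star okK _; rewrite in_star nad orbT.
  - by apply: saturated_star okL _; rewrite in_star adj_sym nad orbT.
  - by left; apply: letter_commute.
have [dv'|dv'] := boolP (d \in component a v').
  apply: (@vanish_outside v' v) => //; rewrite ?nad //.
  - by rewrite comp_sym.
  - by rewrite setUC.
  - have := comp_disjoint v'v; rewrite disjoint_sym => dis.
    by rewrite (disjointFl dis dv').
by apply: (@vanish_outside v v') => //; rewrite nad.
Qed.

End Vanishing.

(** If the two values and their sum are nonzero, a combination of the partner and [al] that vanishes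
    at the two generators satisfies the hypotheses of [vanish], so the partner is proportional to
    [al]. *)
Lemma resonant_special (al : PSigma G -> Z) a v v' :
  v \notin star a -> v' \notin star a -> v' \notin component a v ->
  additive al -> resonant al ->
  [\/ al (pconj a (component a v)) = 0%Z, al (pconj a (component a v')) = 0%Z |
      (al (pconj a (component a v)) + al (pconj a (component a v')) = 0)%Z].
Proof.
move=> va v'a v'v alM [be [beM c0 [g [h gh]]]].
set A := al _; set A' := al (pconj a (component a v')).
have [A0|A0] := pselect (A = 0%Z); first by constructor 1.
have [A'0|A'0] := pselect (A' = 0%Z); first by constructor 2.
have [AA|AA] := pselect ((A + A')%Z = 0%Z); first by constructor 3.
(* Chosen so that A be - B al vanishes at the first generator; commutation of the two then makes it
   vanish at the second. *)
pose B := be (pconj a (component a v)).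
pose be' x := (A * be x + (- B) * al x)%Z.
have be'M : additive be' by apply: additive_comb.
have c0' x y : commute x y -> (al x * be' y = al y * be' x)%Z.
  move=> /c0 e; rewrite /be'.
  transitivity (A * (al x * be y) - B * (al x * al y))%Z; first by ring.
  by rewrite e; ring.
have K0 : be' (pconj a (component a v)) = 0%Z by rewrite /be' -/A -/B; lia.
have okK := saturated_comp a v; have okK' := saturated_comp a v'.
have KK' : [disjoint component a v & component a v'].
  by rewrite disjoint_sym; apply: comp_disjoint.
have K'0 : be' (pconj a (component a v')) = 0%Z.
  by have := c0' _ _ (pconj_commute_base okK okK'); rewrite K0 -/A; nia.
have kill y : be' y = 0%Z -> al y <> 0%Z ->
    forall x, commute x y -> be' x = 0%Z.
  by move=> y0 ay x /c0'; rewrite y0; nia.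
have be'0 : forall x, be' x = 0%Z.
  apply: (@vanish be' a be'M v v') => //.
  - exact: kill.
  - exact: kill.
  - apply: kill; rewrite pconj_union // ?be'M ?alM ?K0 ?K'0 //.
have e : (A * (al g * be h - al h * be g) = al g * be' h - al h * be' g)%Z.
  by rewrite /be'; ring.
rewrite !be'0 in e; case: gh.
have [|]: A = 0%Z \/ (al g * be h - al h * be g)%Z = 0%Z.
- by apply: Zmult_integral; lia.
  by [].
by lia.
Qed.

End PSigmaResonance.

(** * Characters of [PSigma] obtained from a free group of rank two *)

Definition discrete2 : sgraph :=
  @SGraph bool (fun _ _ => false) (fun _ _ => erefl) (fun _ => erefl).

Notation F2 := (raag discrete2).

Lemma F2_center (p : F2) :
  (forall t : discrete2, commute p (raag_gen t)) -> p = 1.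
Proof.
move=> pC; apply/eqP/negPn/negP => /eqP/begins_neq1[l lp].
have := commute_begins (pC (~~ l.1 : discrete2)) lp.
by rewrite in_star orbF; case: l.1.
Qed.

Lemma F2_cup0 (p q : F2) : commute p q ->
  (ex (true : discrete2) p * ex (false : discrete2) q =
   ex (true : discrete2) q * ex (false : discrete2) p)%Z.
Proof. exact: expo_minor. Qed.

Section Twist.
Variable G : sgraph.
Implicit Types (a b c d u v w : G) (K L : {set G}) (x y : PSigma G).

Lemma conjugator_exists x : exists z : G -> raag G,
  forall v, psig_val x (raag_gen v) = z v * raag_gen v * (z v)^-1.
Proof.
have /asboolP/choice[g xg] := valP x; exists (fun v => (g v)^-1) => v.
by rewrite xg conjgE invgK mulgA.
Qed.

Definition conjugator x : G -> raag G := projT1 (cid (conjugator_exists x)).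

Lemma conjugatorP x v : psig_val x (raag_gen v) =
  conjugator x v * raag_gen v * (conjugator x v)^-1.
Proof. exact: (projT2 (cid (conjugator_exists x))). Qed.

Lemma conjugator_sub x v z :
  psig_val x (raag_gen v) = z * raag_gen v * z^-1 ->
  gen_sub (star v) (z^-1 * conjugator x v).
Proof.
rewrite conjugatorP => e; apply: centralizer_gen; rewrite /commute.
apply: (mulgI z); apply: (mulIg (conjugator x v)^-1).
by rewrite !mulgA mulgV mul1g e mulgK.
Qed.

(** The character dual to (a, K), for K the component of [v]. The conjugator is determined up to the
    star subgroup of [v], so the choice is immaterial when [v] is outside the star of [a]. *)
Definition twist a v x := ex a (conjugator x v).

Lemma twistE a v x z : v \notin star a ->
  psig_val x (raag_gen v) = z * raag_gen v * z^-1 -> twist a v x = ex a z.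
Proof.
move=> va /conjugator_sub e; have := gen_sub_ex e (v := a).
by rewrite star_sym va (exM a) (additiveV (exM a)) /twist => /(_ isT); lia.
Qed.

Lemma conjugatorM x y v : psig_val (x * y) (raag_gen v) =
  psig_val x (conjugator y v) * conjugator x v * raag_gen v *
  (psig_val x (conjugator y v) * conjugator x v)^-1.
Proof.
rewrite PSigmaM autM conjugatorP !aut_funM conjugatorP.
by rewrite (morphV (aut_funM (psig_val x))) invgM !mulgA.
Qed.

Lemma twistM a v : v \notin star a -> additive (twist a v).
Proof.
move=> va x y; rewrite (twistE va (conjugatorM x y v)) (exM a) pure_ex.
  by rewrite /twist; lia.
exact: valP x.
Qed.

Lemma twist_pconj a v d K : v \notin star a -> saturated d K ->
  twist a v (pconj d K) = if (d == a) && (v \in K) then 1%Z else 0%Z.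
Proof.
move=> va okK; have := pc_genE (l := (d, true)) v okK; case: ifP => vK e.
  rewrite (@twistE _ _ _ (letter (d, true))) // ?ex_letter ?andbT //.
  by rewrite -letter_linv.
rewrite (@twistE _ _ _ 1) // ?(additive1 (exM a)) ?andbF //.
by rewrite invg1 mul1g mulg1.
Qed.

Section Retraction.
Variables a b : G.
Hypothesis ab : a != b.
Hypothesis nab : ~~ adj a b.

Definition retr_gen v : F2 :=
  if v == a then raag_gen (true : discrete2)
  else if v == b then raag_gen (false : discrete2) else 1.

Lemma retr_comm u v : adj u v -> commute (retr_gen u) (retr_gen v).
Proof.
rewrite /retr_gen; case: (u =P a) => [->|_].
  case: (v =P a) => [->|_]; first by rewrite adj_irr.
  by case: (v =P b) => [->|_ _]; [rewrite (negbTE nab) | apply: commute1].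
case: (u =P b) => [->|_ _]; last exact/commute_sym/commute1.
case: (v =P a) => [->|_]; first by rewrite adj_sym (negbTE nab).
by case: (v =P b) => [->|_ _]; [rewrite adj_irr | apply: commute1].
Qed.

Definition retr : raag G -> F2 := raag_lift retr_gen.

Lemma retrM : {morph retr : p q / p * q}.
Proof. by apply: liftM; apply: retr_comm. Qed.

Lemma retrE v : retr (raag_gen v) = retr_gen v.
Proof. by apply: lift_gen; apply: retr_comm. Qed.

Lemma retr_a : retr (raag_gen a) = raag_gen (true : discrete2).
Proof. by rewrite retrE /retr_gen eqxx. Qed.

Lemma retr_b : retr (raag_gen b) = raag_gen (false : discrete2).
Proof. by rewrite retrE /retr_gen eq_sym (negbTE ab) eqxx. Qed.

Lemma retr_1 v : v != a -> v != b -> retr (raag_gen v) = 1.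
Proof. by rewrite retrE /retr_gen => /negbTE-> /negbTE->. Qed.

Lemma retr_gen_sub S p : gen_sub S p -> a \notin S -> b \notin S -> retr p = 1.
Proof.
move=> Sp aS bS; elim: Sp => [|l q lS _ IH]; first exact: morph1 retrM.
have l1 : retr (raag_gen l.1) = 1.
  by apply: retr_1; [apply: contraNneq aS | apply: contraNneq bS] => <-.
by rewrite retrM IH letterE; case: l.2; rewrite ?(morphV retrM) l1 ?invg1 mulg1.
Qed.

Lemma ex_retr_a p : ex (true : discrete2) (retr p) = ex a p.
Proof.
have eM : additive (fun p => ex (true : discrete2) (retr p)).
  by move=> q r; rewrite retrM exM.
apply: (additive_ext eM (exM a)) => v; rewrite ex_gen.
rewrite retrE /retr_gen; case: (v =P a) => [_|va]; first by rewrite ex_gen.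
by case: (v =P b) => _; rewrite ?ex_gen // (additive1 (exM _)).
Qed.

Lemma ex_retr_b p : ex (false : discrete2) (retr p) = ex b p.
Proof.
have eM : additive (fun p => ex (false : discrete2) (retr p)).
  by move=> q r; rewrite retrM exM.
apply: (additive_ext eM (exM b)) => v; rewrite ex_gen.
rewrite retrE /retr_gen; case: (v =P a) => [->|va].
  by rewrite ex_gen (negbTE ab).
by case: (v =P b) => _; rewrite ?ex_gen // (additive1 (exM _)).
Qed.

(** Only [a] and [b] matter. A letter on another vertex dies under [retr]; a letter on one of the
    two commutes with it, so moving the other alone is already inner. *)
Lemma retr_pc l K : saturated l.1 K ->
  exists k, forall p, retr (pc l K p) = k * retr p * k^-1.
Proof.
move=> okK; exists (if (a \in K) || (b \in K) then retr (letter l) else 1).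
set k := if _ then _ else _ => p.
have fM : {morph (fun p => retr (pc l K p)) : x y / x * y}.
  by move=> x y; rewrite aut_funM retrM.
have gM : {morph (fun p => k * retr p * k^-1) : x y / x * y}.
  by move=> x y; rewrite retrM !mulgA mulgVK.
apply: (raag_ext fM gM) => v; rewrite pc_genE //.
have conjK : retr (letter l * raag_gen v * letter (linv l)) =
    retr (letter l) * retr (raag_gen v) * (retr (letter l))^-1.
  by rewrite !retrM letter_linv (morphV retrM).
have triv : v != a -> v != b -> forall q, q * retr (raag_gen v) * q^-1 = 1.
  by move=> va vb q; rewrite retr_1 // mulg1 mulgV.
have lK := saturated_base okK.
have self : (a \in K) || (b \in K) -> v \notin K -> (v == a) || (v == b) ->
    retr (letter l) * retr (raag_gen v) * (retr (letter l))^-1 = retr (raag_gen v).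
  move=> abK vK vab.
  have [lv|lv] := eqVneq l.1 v.
    have c : commute (letter l) (raag_gen v) by apply/commute_letterP; rewrite lv.
    by rewrite (morph_commute retrM c) mulgK.
  have l1 : retr (raag_gen l.1) = 1.
    apply: retr_1.
      case/orP: vab => /eqP e; first by rewrite -e.
      apply: contraNneq lK => ->; case/orP: abK => // bK.
      by rewrite e bK in vK.
    case/orP: vab => /eqP e; last by rewrite -e.
    apply: contraNneq lK => ->; case/orP: abK => // aK.
    by rewrite e aK in vK.
  have -> : retr (letter l) = 1.
    by rewrite letterE; case: l.2; rewrite ?(morphV retrM) l1 ?invg1.
  by rewrite mul1g invg1 mulg1.
have [/orP[]/eqP e|/norP[va vb]] := boolP ((v == a) || (v == b)).
- case: ifP => vK; first by rewrite conjK /k -e vK.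
  rewrite /k; case: ifP => [abK|]; last by rewrite mul1g invg1 mulg1.
  by rewrite self ?vK // e eqxx.
- case: ifP => vK; first by rewrite conjK /k -e vK orbT.
  rewrite /k; case: ifP => [abK|]; last by rewrite mul1g invg1 mulg1.
  by rewrite self ?vK // e eqxx orbT.
rewrite triv //; case: ifP => _; last by rewrite retr_1.
by rewrite conjK triv.
Qed.

(* [retr] kills a normal subgroup preserved by the pure symmetric automorphisms,
   and those of the free group on [a], [b] are inner. *)
Lemma retr_inner x : exists g : F2,
  forall p, retr (psig_val x p) = g * retr p * g^-1.
Proof.
apply: (pc_generate (P := fun f : aut (raag G) => exists g : F2,
  forall p, retr (f p) = g * retr p * g^-1)).
- by exists 1 => p; rewrite mul1g invg1 mulg1.
- move=> f l v [g fg]; have [k pk] := retr_pc (saturated_comp l.1 v).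
  by exists (g * k) => p; rewrite autM fg pk invgM !mulgA.
- exact: valP x.
Qed.

Definition inner_part x : F2 := projT1 (cid (retr_inner x)).

Lemma inner_partP x p :
  retr (psig_val x p) = inner_part x * retr p * (inner_part x)^-1.
Proof. exact: (projT2 (cid (retr_inner x))). Qed.

Lemma inner_part_uniq (g h : F2) :
  (forall p, g * retr p * g^-1 = h * retr p * h^-1) -> g = h.
Proof.
move=> gh; apply/esym/divg1_eq; rewrite -[h / g]invgK invgF.
suff : g^-1 * h = 1 by move/mulg1_eq; rewrite invgK => ->; rewrite mulgV invg1.
have all p : commute (g^-1 * h) (retr p).
  rewrite /commute; apply: (mulgI g); apply: (mulIg h^-1).
  by rewrite !mulgA mulgV mul1g -gh mulgK.
by apply: F2_center => -[]; rewrite -?retr_a -?retr_b; apply: all.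
Qed.

Lemma inner_partM : {morph inner_part : x y / x * y}.
Proof.
move=> x y; apply: inner_part_uniq => p.
by rewrite -inner_partP PSigmaM autM !inner_partP invgM !mulgA.
Qed.

(** The inner part and the retracted conjugator send [t] to the same conjugate; they differ by a
    centralizing factor, which has exponent zero on the other generator. *)
Lemma inner_part_twist v (t : discrete2) x :
  retr (raag_gen v) = raag_gen t ->
  forall s : discrete2, s != t ->
  ex s (inner_part x) = ex s (retr (conjugator x v)).
Proof.
move=> vt s st; have := inner_partP x (raag_gen v).
rewrite conjugatorP !retrM (morphV retrM) vt.
set g := inner_part x; set z := retr _ => e.
have c : commute (g^-1 * z) (raag_gen t).
  rewrite /commute; apply: (mulgI g); apply: (mulIg z^-1).
  by rewrite !mulgA mulgV mul1g e mulgK.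
have := gen_sub_ex (centralizer_gen c) (v := s).
by rewrite in_star orbF st (exM s) (additiveV (exM s)) => /(_ isT); lia.
Qed.

Lemma inner_part_true x : ex (true : discrete2) (inner_part x) = twist a b x.
Proof. by rewrite (inner_part_twist x retr_b) // ex_retr_a. Qed.

Lemma inner_part_false x : ex (false : discrete2) (inner_part x) = twist b a x.
Proof. by rewrite (inner_part_twist x retr_a) // ex_retr_b. Qed.

Lemma twist_cup0 : cup0 (twist a b) (twist b a).
Proof.
move=> x y xy; rewrite -!inner_part_true -!inner_part_false.
by apply: F2_cup0; apply: morph_commute inner_partM _ _ xy.
Qed.

Variable c : G.
Hypothesis ca : c \notin star a.
Hypothesis cb : c \notin star b.

(* [x] acts on the quotient by the normal closure of the other generators as an
   inner automorphism of [<a, b>] followed by a conjugation of [c]. *)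
Definition outer_part x : F2 := (inner_part x)^-1 * retr (conjugator x c).

(** The ambiguity in the conjugator of [c] lies in the star subgroup of [c], which [retr] kills.
    Conjugation by [inner_part x] then cancels, and the order of the factors is reversed; commuting
    pairs are still preserved. *)
Lemma outer_partM x y : outer_part (x * y) = outer_part y * outer_part x.
Proof.
rewrite /outer_part inner_partM.
have /retr_gen_sub := conjugator_sub (conjugatorM x y c).
rewrite 2!(star_sym _ c) => /(_ ca cb); rewrite retrM (morphV retrM) => e.
have -> : retr (conjugator (x * y) c) =
    retr (psig_val x (conjugator y c)) * retr (conjugator x c).
  by rewrite -retrM; apply/esym/divg1_eq; rewrite -[_ / _]invgK invgF;
     move/mulg1_eq: e; rewrite invgK => ->; rewrite mulgV invg1.
by rewrite inner_partP invgM !mulgA mulgVK.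
Qed.

Lemma outer_part_ex x :
  (ex (true : discrete2) (outer_part x) = twist a c x - twist a b x)%Z /\
  (ex (false : discrete2) (outer_part x) = twist b c x - twist b a x)%Z.
Proof.
rewrite /outer_part !exM !(additiveV (exM _)) inner_part_true inner_part_false.
by rewrite ex_retr_a ex_retr_b /twist; split; lia.
Qed.

Lemma twist_diff_cup0 :
  cup0 (fun x => twist a c x - twist a b x)%Z
       (fun x => twist b c x - twist b a x)%Z.
Proof.
move=> x y xy; have [<- <-] := outer_part_ex x; have [<- <-] := outer_part_ex y.
by apply: F2_cup0; rewrite /commute -!outer_partM xy.
Qed.

End Retraction.
End Twist.

(** * Resonant characters of graph groups *)

Lemma parallel_trans (x0 y0 x1 y1 x2 y2 : Z) : x1 <> 0%Z \/ y1 <> 0%Z ->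
  (x1 * y0 = x0 * y1)%Z -> (x1 * y2 = x2 * y1)%Z -> (x2 * y0 = x0 * y2)%Z.
Proof.
move=> [nz|nz] e0 e2; apply: (Z.mul_reg_l _ _ _ nz).
  transitivity (x2 * (x1 * y0))%Z; first by ring.
  rewrite e0; transitivity (x0 * (x2 * y1))%Z; first by ring.
  by rewrite -e2; ring.
transitivity (x2 * y1 * y0)%Z; first by ring.
rewrite -e2; transitivity (x1 * y0 * y2)%Z; first by ring.
by rewrite e0; ring.
Qed.

Section ResonanceOfRaag.
Variables (H : groupType) (D : sgraph) (F : H -> raag D) (F' : raag D -> H).
Hypothesis FM : {morph F : x y / x * y}.
Hypothesis FK : cancel F F'.
Hypothesis F'K : cancel F' F.
Implicit Types (al be : H -> Z) (f g : D -> Z) (u v w : D).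

Definition values al v := al (F' (raag_gen v)).

Definition of_values f x := expo f (F x).

Lemma of_valuesM f : additive (of_values f).
Proof. by move=> x y; rewrite /of_values FM expoM. Qed.

Lemma of_valuesK f : values (of_values f) =1 f.
Proof. by move=> v; rewrite /values /of_values F'K expo_gen. Qed.

Lemma valuesK al : additive al -> of_values (values al) =1 al.
Proof.
move=> alM x; rewrite /of_values -[in RHS](FK x).
have F'M : {morph F' : p q / p * q}.
  by move=> p q; apply: (can_inj FK); rewrite FM !F'K.
have eM : additive (al \o F') by move=> p q; rewrite /= F'M alM.
by apply: (additive_ext (expoM _) eM) => v; rewrite expo_gen.
Qed.

Lemma of_values_cup0 f g :
  (forall u v, adj u v -> (f u * g v = f v * g u)%Z) ->
  cup0 (of_values f) (of_values g).
Proof. by move=> fg x y xy; apply: expo_minor => //; apply: morph_commute xy. Qed.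

Lemma cup0_values al be u v : cup0 al be -> adj u v ->
  (values al u * values be v = values al v * values be u)%Z.
Proof.
move=> c0 uv; apply: c0; rewrite /commute; apply: (can_inj FK).
by rewrite !FM !F'K; apply: gen_commute.
Qed.

(** If all minors on generators vanish, additivity in one argument and then in the other makes all
    minors vanish. *)
Lemma indep_values al be : additive al -> additive be -> indep al be ->
  exists u v, (values al u * values be v <> values al v * values be u)%Z.
Proof.
move=> alM beM [x [y]]; apply: contra_notP => no.
have m0 u v : (values al u * values be v = values al v * values be u)%Z.
  by apply: contrapT => h; apply: no; exists u, v.
have lin be1 be2 s t : additive be1 -> additive be2 ->
    (forall u, (s * values be1 u = t * values be2 u)%Z) ->
    forall z, (s * be1 z = t * be2 z)%Z.
  move=> b1 b2 h z; rewrite -(valuesK b1) -(valuesK b2) /of_values.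
  have e1 : additive (fun p => s * expo (values be1) p)%Z.
    by move=> p q; rewrite expoM; lia.
  have e2 : additive (fun p => t * expo (values be2) p)%Z.
    by move=> p q; rewrite expoM; lia.
  by apply: (additive_ext e1 e2) => u; rewrite !expo_gen.
have step u z : (values al u * be z = values be u * al z)%Z.
  by apply: lin => // v; rewrite m0; lia.
have := lin be al (al x) (be x) beM alM _ y; rewrite [(be x * _)%Z]Z.mul_comm.
by apply=> u; have := step u x; rewrite /values; lia.
Qed.

(* Over a graph group, resonance only depends on supports: every nonzero [al']
   supported in the union of the supports of [al] and [be] is resonant.  On that
   union the direction of [(al v, be v)] is constant on connected components and
   takes at least two values, so the induced subgraph is disconnected. *)
Lemma resonant_support al be al' :
  additive al -> additive be -> cup0 al be -> indep al be ->
  additive al' ->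
  (forall v, values al v = 0%Z -> values be v = 0%Z -> values al' v = 0%Z) ->
  (exists x, al' x <> 0%Z) -> resonant al'.
Proof.
move=> alM beM c0 ind al'M supp [x al'x].
set A := values al in supp *; set B := values be in supp *.
set A' := values al' in supp *.
have [u0 Au0] : exists u, A' u <> 0%Z.
  apply: contra_notP al'x => no; rewrite -(valuesK al'M) /of_values.
  have z1 : additive (fun _ : raag D => 0%Z) by [].
  apply: (additive_ext (expoM _) z1) => u; rewrite expo_gen.
  by apply: contrapT => h; apply: no; exists u.
(* [par] marks the vertices whose vector [(A v, B v)] is parallel to that of [u0]. *)
pose par v := (A v * B u0 =? A u0 * B v)%Z.
have parP v : reflect (A v * B u0 = A u0 * B v)%Z (par v).
  by apply: (iffP idP) => [/Z.eqb_eq|/Z.eqb_eq].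
have nz0 : A u0 <> 0%Z \/ B u0 <> 0%Z.
  have [a0|] := pselect (A u0 = 0%Z); last by left.
  by right => b0; apply: Au0; apply: supp.
have par_adj u v : adj u v -> (A u <> 0%Z \/ B u <> 0%Z) ->
    par u -> par v.
  move=> uv nz /parP pu; apply/parP; have e : (A u * B v = A v * B u)%Z.
    exact: cup0_values.
  exact: parallel_trans nz pu e.
have [v1 [v1par v1nz]] : exists v, ~~ par v /\ (A v <> 0%Z \/ B v <> 0%Z).
  have [u [v uv]] := indep_values alM beM ind.
  have [pu|pu] := boolP (par u); last first.
    exists u; split=> //; have [a0|] := pselect (A u = 0%Z); last by left.
    right => b0; move/negP: pu; apply; apply/parP; rewrite a0 b0; lia.
  have [pv|pv] := boolP (par v); last first.
    exists v; split=> //; have [a0|] := pselect (A v = 0%Z); last by left.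
    right => b0; move/negP: pv; apply; apply/parP; rewrite a0 b0; lia.
  case: uv; move/parP: pu; move/parP: pv; rewrite -/A -/B => pv pu.
  exact: parallel_trans nz0 (esym pv) (esym pu).
have [[v2 [v2par v2nz]]|no] := pselect (exists v, ~~ par v /\ A' v <> 0%Z).
  (* When [al'] is nonzero off the class of [u0] too, its restriction to the class is a partner: by
     [par_adj] no edge of the support of [al'] leaves the class. *)
  pose f v := if par v then A' v else 0%Z.
  exists (of_values f); split; first exact: of_valuesM.
    move=> y z yz; rewrite -!(valuesK al'M); apply: of_values_cup0 yz => u v uv.
    rewrite -/A' /f; case pu: (par u); case pv: (par v); rewrite ?Z.mul_0_r //.
    - exact: Z.mul_comm.
    - have [a0|a0] := pselect (A u = 0%Z); last first.
        by rewrite (par_adj u v) // in pv; left.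
      have [b0|b0] := pselect (B u = 0%Z); last first.
        by rewrite (par_adj u v) // in pv; right.
      by rewrite (supp u) // Z.mul_0_r.
    - rewrite adj_sym in uv.
      have [a0|a0] := pselect (A v = 0%Z); last first.
        by rewrite (par_adj v u) // in pu; left.
      have [b0|b0] := pselect (B v = 0%Z); last first.
        by rewrite (par_adj v u) // in pu; right.
      by rewrite (supp v) // Z.mul_0_r.
  exists (F' (raag_gen u0)), (F' (raag_gen v2)).
  rewrite -!/(values _ _) !of_valuesK -/A' /f (negbTE v2par).
  have -> : par u0 by apply/parP; lia.
  nia.
have par0 v : ~~ par v -> A' v = 0%Z.
  by move=> nv; apply: contrapT => h; apply: no; exists v.
(* Otherwise [al'] lives on the class of [u0], and the partner is the indicator of the other
   directions, nonzero at [v1]. *)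
pose f v := if par v || ((A v =? 0) && (B v =? 0))%Z then 0%Z else 1%Z.
exists (of_values f); split; first exact: of_valuesM.
  have halfspace u v : adj u v -> (A' u * f v = 0)%Z.
    move=> uv; rewrite /f; have [pu|pu] := boolP (par u); last by rewrite par0.
    have [a0|a0] := pselect (A u = 0%Z); last first.
      by rewrite (par_adj u v) //= ?Z.mul_0_r //; left.
    have [b0|b0] := pselect (B u = 0%Z); last first.
      by rewrite (par_adj u v) //= ?Z.mul_0_r //; right.
    by rewrite supp.
  move=> y z yz; rewrite -!(valuesK al'M); apply: of_values_cup0 yz => u v uv.
  by rewrite -/A' halfspace // halfspace // adj_sym.
exists (F' (raag_gen u0)), (F' (raag_gen v1)).
rewrite -!/(values _ _) !of_valuesK -/A' /f (negbTE v1par) (par0 v1) //=.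
have -> : ((A v1 =? 0) && (B v1 =? 0))%Z = false.
  by apply/negbTE/negP => /andP[/Z.eqb_eq a0 /Z.eqb_eq b0]; case: v1nz.
lia.
Qed.

End ResonanceOfRaag.

(** * Three resonant lines in a plane, and the equivalence *)

Section NotRaag.
Variables (G : sgraph) (D : sgraph).
Variables (F : PSigma G -> raag D) (F' : raag D -> PSigma G).
Hypothesis FM : {morph F : x y / x * y}.
Hypothesis FK : cancel F F'.
Hypothesis F'K : cancel F' F.

(** On (a, K), (a, C), with K and C the components of [b] and [c], the characters [al0], [al1],
    [al2] take the values (1, 0), (-1, 1), (0, 1). Since al2 = al0 + al1, [al2] is cut into a piece
    supported with [al0] and one supported with [al1]; perturbing the pieces leads off the special
    lines. *)
Lemma not_separated (a b c : G) : ~ separated a b c.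
Proof.
move=> [ab nab [ca cb] [bac abc]].
have ba : b \notin star a by rewrite in_star negb_or eq_sym ab.
have ab' : a \notin star b by rewrite star_sym.
have ac : a \notin star c by rewrite star_sym.
have cab : c \notin component a b by rewrite comp_sym.
have okb := saturated_comp a b; have okc := saturated_comp a c.
have acn : a != c by apply: contraNneq ca => ->; rewrite in_star eqxx.
have nac : ~~ adj a c by apply: contra ca; rewrite in_star => ->; rewrite orbT.
have ba' := eq_sym b a.
pose al0 := twist a b; pose be0 := twist b a.
pose al1 x := (twist a c x - twist a b x)%Z.
pose be1 x := (twist b c x - twist b a x)%Z.
pose al2 := twist a c; pose be2 := twist c a.
have al0M : additive al0 by apply: twistM.
have be0M : additive be0 by apply: twistM.
have al2M : additive al2 by apply: twistM.
have be2M : additive be2 by apply: twistM.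
have bcM : additive (twist b c) by apply: twistM.
have al1M : additive al1.
  move=> x y; have := al2M x y; have := al0M x y; rewrite /al1 /al0 /al2; lia.
have be1M : additive be1.
  move=> x y; have := bcM x y; have := be0M x y; rewrite /be1 /be0; lia.
have c0 : cup0 al0 be0 by apply: twist_cup0.
have c1 : cup0 al1 be1 by apply: twist_diff_cup0.
have c2 : cup0 al2 be2 by apply: twist_cup0.
have i0 : indep al0 be0.
  exists (pconj a (component a b)), (pconj b (component b a)).
  rewrite /al0 /be0 !twist_pconj ?saturated_comp // !eqxx !comp_id //.
  by rewrite ba' (negbTE ab).
have i2 : indep al2 be2.
  exists (pconj a (component a c)), (pconj c (component c a)).
  rewrite /al2 /be2 !twist_pconj ?saturated_comp // !eqxx !comp_id //.
  by rewrite [c == a]eq_sym (negbTE acn).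
have i1 : indep al1 be1.
  exists (pconj a (component a c)), (pconj b (component b c)).
  rewrite /al1 /be1 !twist_pconj ?saturated_comp // !eqxx !comp_id //.
  by rewrite ba' (negbTE ab) (negbTE bac) (negbTE abc).
pose W0 v := ((values F' al0 v =? 0) && (values F' be0 v =? 0))%Z.
have W0P v : reflect (values F' al0 v = 0%Z /\ values F' be0 v = 0%Z) (W0 v).
  apply: (iffP andP) => -[h h']; split; exact/Z.eqb_eq.
(* [al'] is [al2] restricted to the union of the supports of [al0] and [be0]. Off that union [al0]
   is zero and [al2] equals [al1], so [al''] is supported where [al1] is. *)
pose al' := of_values F (fun v => if W0 v then 0%Z else values F' al2 v).
pose al'' x := (al2 x - al' x)%Z.
have al'M : additive al' by apply: of_valuesM.
have al''M : additive al''.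
  move=> x y; have := al2M x y; have := al'M x y; rewrite /al''; lia.
have val' v : values F' al' v = if W0 v then 0%Z else values F' al2 v.
  exact: of_valuesK.
have special f al be : additive al -> additive be -> cup0 al be -> indep al be ->
    additive f ->
    (forall v, values F' al v = 0%Z -> values F' be v = 0%Z ->
               values F' f v = 0%Z) ->
    [\/ f (pconj a (component a b)) = 0%Z, f (pconj a (component a c)) = 0%Z |
        (f (pconj a (component a b)) + f (pconj a (component a c)) = 0)%Z].
  move=> alM beM cc ii fM supp; have [nz|z] := pselect (exists x, f x <> 0%Z).
    apply: resonant_special => //.
    exact: (resonant_support FM FK F'K alM beM cc ii fM supp nz).
  by constructor 1; apply: contrapT => h; apply: z; eexists; exact: h.
have sp0 t := special (fun x => 1 * al' x + t * al0 x)%Z al0 be0 al0M be0M c0 i0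
  (additive_comb 1 t al'M al0M).
have sp2 t := special (fun x => 1 * al' x + t * al2 x)%Z al2 be2 al2M be2M c2 i2
  (additive_comb 1 t al'M al2M).
have sp1 := special (fun x => 1 * al'' x + 1 * al1 x)%Z al1 be1 al1M be1M c1 i1
  (additive_comb 1 1 al''M al1M).
have v0 K : saturated a K -> al0 (pconj a K) = if b \in K then 1%Z else 0%Z.
  by move=> okK; rewrite /al0 twist_pconj // eqxx.
have v2 K : saturated a K -> al2 (pconj a K) = if c \in K then 1%Z else 0%Z.
  by move=> okK; rewrite /al2 twist_pconj // eqxx.
have al1E x : al1 x = (al2 x - al0 x)%Z by [].
have al''E x : al'' x = (al2 x - al' x)%Z by [].
move: sp0 sp1 sp2; rewrite !al1E !al''E !v0 // !v2 //.
rewrite !comp_id // (negbTE cab) (negbTE bac).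
set k := al' _; set e := al' _ => sp0 sp1 sp2.
have {}sp0 t : [\/ (1 * k + t * 1 = 0)%Z, (1 * e + t * 0 = 0)%Z |
    (1 * k + t * 1 + (1 * e + t * 0) = 0)%Z].
  apply: sp0 => v h h'; move: (val' v); rewrite /values in h h' *.
  by rewrite h => ->; rewrite (introT (W0P v)) //; lia.
have {}sp2 t : [\/ (1 * k + t * 0 = 0)%Z, (1 * e + t * 1 = 0)%Z |
    (1 * k + t * 0 + (1 * e + t * 1) = 0)%Z].
  apply: sp2 => v h h'; move: (val' v); rewrite /values in h h' *.
  by rewrite h => ->; case: ifP => _; lia.
have {}sp1 : [\/ (1 * (0 - k) + 1 * (0 - 1) = 0)%Z,
    (1 * (1 - e) + 1 * (1 - 0) = 0)%Z |
    (1 * (0 - k) + 1 * (0 - 1) + (1 * (1 - e) + 1 * (1 - 0)) = 0)%Z].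
  apply: sp1 => v h h'; move: (val' v) (W0P v); rewrite /values al''E al1E in h h' *.
  case: (W0 v) => -> w0; last by lia.
  by case/(elimT w0): isT; rewrite /values; lia.
(* The multiplier makes both k + t and k + t + e positive, leaving only e = 0; the next line is
   symmetric. *)
have e0 : e = 0%Z by case: (sp0 (1 + Z.abs k + Z.abs e)%Z); lia.
have k0 : k = 0%Z by case: (sp2 (1 + Z.abs k + Z.abs e)%Z); lia.
(* The sum of [al''] and [al1] now takes the values -1 and 2, which lie on no special line. *)
by case: sp1; lia.
Qed.

End NotRaag.

Theorem theorem2 (G : sgraph) : is_raag (PSigma G) <-> ~ has_SIL G.
Proof.
split=> [[D [F [F' FK F'K]]] /has_SIL_separated[a [b [c abc]]]|noSIL].
  by apply: (@not_separated G D F F' _ FK F'K a b c abc); exact: gmulfM.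
apply: no_separation_is_raag => a b c /separated_has_SIL; exact: noSIL.
Qed.
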